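(* Let $$S_0(z):=\frac{\mathrm{Li}_4(1)}{\mathrm{Li}_4(1)-\mathrm{Li}_4(z)}$$ and, for $n\ge 0$, let $S_n:=[z^n]S_0(z)$ be the coefficient of $z^n$ in the power series expansion of $S_0$ at $z=0$. Then, as $n\to\infty$, the asymptotic expansion of $S_n$ up to the $1/n^3$ term is $$S_n=\frac{\pi^4}{90\,\zeta(3)}+\frac{\pi^4}{540\,\zeta(3)^2n^2}-\frac{\pi^6}{1620\,\zeta(3)^3n^3}+o\!\left(\frac1{n^3}\right).$$
   Context: $\mathrm{Li}_4(z):=\sum_{n=1}^{\infty}\frac{z^n}{n^4}$ is the polylogarithm of order $4$ (for $|z|\le 1$), and $\zeta$ is the Riemann zeta function. *)

(* Defs.v *)
From Stdlib Require Import Reals.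
From Coquelicot Require Import Coquelicot.

(* Sum of a convergent complex series; [Series] is only defined on real ones. *)
Definition CSeries (a : nat -> C) : C :=
  (Series (fun n => Re (a n)), Series (fun n => Im (a n))).

(* Polylogarithm of order [s], meaningful where the series converges (for
   [s >= 2], on [Cmod z <= 1]).  The sum over n >= 1 is reindexed from 0. *)
Definition Li (s : nat) (z : C) : C :=
  CSeries (fun n => Cdiv (Cpow z (S n)) (RtoC (INR (S n) ^ s))).

(* Riemann zeta function on the half-line [1 < s], where the series converges. *)
Definition zeta (s : R) : R :=
  Series (fun n => / Rpower (INR (S n)) s)%R.

Definition S0 (z : C) : C :=
  Cdiv (Li 4 (RtoC 1)) (Cminus (Li 4 (RtoC 1)) (Li 4 z)).

(* [a] is the sequence of coefficients of the power series expansion of [f]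
   at 0: the series converges to [f] on some disc of positive radius. *)
Definition power_series_at_0 (f : C -> C) (a : nat -> C) : Prop :=
  exists r : posreal, forall z : C, (Cmod z < r)%R -> is_pseries a z (f z).

(* Main.v *)
Require Import Defs.
From Stdlib Require Import Reals Lra Lia Arith FunctionalExtensionality.
From Coquelicot Require Import Coquelicot.
Local Open Scope R_scope.

(** Write [zeta 4 - Li 4 z = (1 - z) R(z)] and [(1 - z) Q(z) = mu - R(z)], where
    [R] and [Q] are generated by the first and second iterated tails of [1/j^4] and
    [mu = R(1) = zeta 3].  With [V = 1/R] and [U = V / (1 - z)], so that
    [S0 = zeta 4 * U], one finds [mu U = 1/(1 - z) + Q V] and [mu Q V = Q + P] for
    [P = (1 - z) Q^2 V].  The coefficients of [Q] are known to order [1/n^3] by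
    comparing second differences.  Those of [P] come from the Euler derivative
    [theta = z d/dz]: [theta P] is a polynomial in [z, Q, V, theta R, mu], all of
    whose coefficient sequences [a] have [n^2 a_n] convergent, a class on which the
    pair ([lim n^2 a_n], [sum a_n]) is multiplicative in the dual-number sense.

    That [V] is in this class, with limit 0, replaces Wiener's lemma: [R] has
    log-convex coefficients, so by Kaluza's theorem those of [V] are nonpositive
    from index 1 on and are dominated by those of [R]. *)

(** * Formal power series as a ring *)

(** Besides its simple pole, [S0] has a logarithmic singularity at z = 1, so its expansion cannot be
    read off from poles, and everything is done on coefficient sequences. The obstacle is the factor
    1 - z in P: the limit of [n^2 a_n] says nothing about [n^3 (a_n - a_(n-1))], so P cannot be
    estimated by differencing Q^2 V. Applying theta supplies the missing factor n instead, and the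
    factor 1 - z then either becomes -z or meets Q or theta Q, where the defining relation of Q
    absorbs it.

    The sum of Q, equal to (zeta 2 - zeta 3) / 2, is what brings zeta 2 into the 1/n^3 term. Only
    zeta 2 and zeta 4 have to be evaluated, since zeta 3 stays in the result. *)

Notation fps := (nat -> R).
Definition fps_const (c : R) : fps := fun n => match n with O => c | S _ => 0 end.
Definition fps_X : fps := fun n => match n with 1%nat => 1 | _ => 0 end.
Definition fps_add (a b : fps) : fps := fun n => a n + b n.
Definition fps_opp (a : fps) : fps := fun n => - a n.
Definition fps_sub (a b : fps) : fps := fun n => a n - b n.
Definition theta (a : fps) : fps := fun n => INR n * a n.

Declare Scope fps_scope.
Delimit Scope fps_scope with fps.
Infix "+" := fps_add : fps_scope.
Infix "*" := PS_mult : fps_scope.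
Infix "-" := fps_sub : fps_scope.
Notation "- a" := (fps_opp a) : fps_scope.

Lemma fps_mul_S_l (a b : fps) n :
  PS_mult a b (S n) = a 0%nat * b (S n) + PS_mult (fun k => a (S k)) b n.
Proof. unfold PS_mult. rewrite decomp_sum by lia. reflexivity. Qed.

Lemma fps_mul_S_r (a b : fps) n :
  PS_mult a b (S n) = PS_mult a (fun k => b (S k)) n + a (S n) * b 0%nat.
Proof.
  unfold PS_mult. rewrite tech5, Nat.sub_diag. f_equal.
  apply sum_eq. intros i Hi. now replace (S n - i)%nat with (S (n - i)) by lia.
Qed.

(** Peeling the first term of one product and the last term of the other leaves the same product of
    coefficients and a shorter instance with one factor shifted, hence the induction over all [a]
    and [b]. *)
Lemma fps_mulC (a b : fps) : PS_mult a b = PS_mult b a.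
Proof.
  apply functional_extensionality; intros n. revert a b.
  induction n as [|n IH]; intros a b.
  - unfold PS_mult; simpl; ring.
  - rewrite fps_mul_S_l, fps_mul_S_r, IH. ring.
Qed.

Lemma fps_mulDl (a b c : fps) : ((a + b) * c = a * c + b * c)%fps.
Proof.
  apply functional_extensionality; intros n. unfold PS_mult, fps_add.
  rewrite <- sum_plus. apply sum_eq; intros; ring.
Qed.

Lemma fps_mul_scal (x : R) (a b : fps) n :
  PS_mult (fun k => x * a k) b n = x * PS_mult a b n.
Proof.
  unfold PS_mult. rewrite scal_sum. apply sum_eq; intros; ring.
Qed.

Lemma fps_mulA (a b c : fps) : (a * (b * c) = a * b * c)%fps.
Proof.
  apply functional_extensionality; intros n. revert a.
  induction n as [|n IH]; intros a.
  - unfold PS_mult; simpl; ring.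
  - rewrite (fps_mul_S_l (a * b)%fps).
    replace (fun k => (a * b)%fps (S k))
      with ((fun k => (a 0%nat * b (S k))%R) + (fun k => a (S k)) * b)%fps
      by (apply functional_extensionality; intros k; now rewrite fps_mul_S_l).
    rewrite fps_mulDl. unfold fps_add at 1.
    rewrite fps_mul_scal, <- IH, (fps_mul_S_l a), (fps_mul_S_l b).
    unfold PS_mult at 4; simpl. ring.
Qed.

Lemma fps_const_mul (c : R) (a : fps) n : (fps_const c * a)%fps n = c * a n.
Proof.
  destruct n as [|n]; [reflexivity|].
  rewrite fps_mul_S_l. unfold PS_mult; simpl.
  rewrite (sum_eq _ (fun _ => 0)), sum_cte by (intros; ring). simpl. ring.
Qed.

Lemma fps_X_mul (a : fps) n : (fps_X * a)%fps (S n) = a n.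
Proof.
  rewrite fps_mul_S_l.
  replace (fun k => fps_X (S k)) with (fps_const 1)
    by (apply functional_extensionality; intros [|k]; reflexivity).
  rewrite fps_const_mul. simpl. ring.
Qed.

Lemma fps_ring_theory :
  ring_theory (fps_const 0) (fps_const 1) fps_add PS_mult fps_sub fps_opp eq.
Proof.
  split; try exact fps_mulC; try exact fps_mulA; try exact fps_mulDl;
    intros; apply functional_extensionality; intros n;
    try (rewrite fps_const_mul); unfold fps_add, fps_sub, fps_opp;
    try (destruct n; simpl); try ring.
Qed.

Add Ring fps_ring : fps_ring_theory.

Lemma theta_mul (a b : fps) : theta (a * b)%fps = (theta a * b + a * theta b)%fps.
Proof.
  apply functional_extensionality; intros n. unfold theta, fps_add, PS_mult.
  rewrite scal_sum, <- sum_plus. apply sum_eq; intros i Hi.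
  rewrite (minus_INR n i) by lia. ring.
Qed.

Lemma theta_add (a b : fps) : theta (a + b)%fps = (theta a + theta b)%fps.
Proof. apply functional_extensionality; intros n; unfold theta, fps_add; ring. Qed.

Lemma theta_sub (a b : fps) : theta (a - b)%fps = (theta a - theta b)%fps.
Proof. apply functional_extensionality; intros n; unfold theta, fps_sub; ring. Qed.

Lemma theta_const (c : R) : theta (fps_const c) = fps_const 0.
Proof. apply functional_extensionality; intros [|n]; unfold theta; simpl; ring. Qed.

Lemma theta_X : theta fps_X = fps_X.
Proof. apply functional_extensionality; intros [|[|n]]; unfold theta; simpl; ring. Qed.

(* The point is that [theta q], which is not summable for [q_n] of order [1/n^2],
   is absent from the right-hand side. *)
Lemma theta_correction (mu : R) (r v q : fps) :
  (r * v = fps_const 1)%fps ->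
  ((fps_const 1 - fps_X) * q = fps_const mu - r)%fps ->
  (theta ((fps_const 1 - fps_X) * (q * q) * v)
   = fps_X * (q * q) * v - q * v * theta r
     - fps_const mu * (q * (v * v) * theta r))%fps.
Proof.
  intros Hrv Hq.
  (* The derivation rule applied to [r * v = 1], then multiplied by [v]. *)
  assert (Hv : (theta v = - (v * v * theta r))%fps).
  { assert (H := f_equal theta Hrv). rewrite theta_mul, theta_const in H.
    transitivity (r * v * theta v)%fps; [rewrite Hrv; ring|].
    transitivity (v * (theta r * v + r * theta v) - v * v * theta r)%fps; [ring|].
    rewrite H; ring. }
  assert (HQ : ((fps_const 1 - fps_X) * theta q = fps_X * q - theta r)%fps).
  { assert (H := f_equal theta Hq).
    rewrite theta_mul, !theta_sub, !theta_const, theta_X in H.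
    transitivity ((fps_const 0 - fps_X) * q + (fps_const 1 - fps_X) * theta q + fps_X * q)%fps; [ring|].
    rewrite H; ring. }
  rewrite !theta_mul, theta_sub, theta_const, theta_X, Hv.
  (* Every occurrence of [theta q] is grouped with a factor 1 - X, which lets [HQ] eliminate it. *)
  transitivity (- fps_X * (q * q) * v
     + (fps_const 2 * ((fps_const 1 - fps_X) * theta q)) * q * v
     - ((fps_const 1 - fps_X) * q) * q * (v * v) * theta r)%fps.
  { replace (fps_const 2) with (fps_const 1 + fps_const 1)%fps; [ring|].
    apply functional_extensionality; intros [|n]; unfold fps_add; simpl; ring. }
  rewrite HQ, Hq.
  replace (fps_const 2) with (fps_const 1 + fps_const 1)%fps
    by (apply functional_extensionality; intros [|n]; unfold fps_add; simpl; ring).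
  (* The [- r] in [mu - r] produces a factor [r * v = 1], which cancels one of the two copies of
     [q * v * theta r]. *)
  transitivity (fps_X * (q * q) * v - (fps_const 1 + fps_const 1) * (q * v * theta r)
     - fps_const mu * (q * (v * v) * theta r) + (r * v) * (q * v * theta r))%fps;
    [ring|].
  rewrite Hrv. ring.
Qed.

(** * The values of zeta at 2 and 4 *)

(** Matsuoka's method: for [p = 0] these are Wallis integrals, and integration by parts relates the
    moments of orders [p] and [p + 2]. *)
Definition cos_moment (p n : nat) : R :=
  RInt (fun x => x ^ p * cos x ^ (2 * n)) 0 (PI / 2).

Lemma ex_RInt_pow_cos (p n : nat) (a b : R) :
  ex_RInt (fun x => x ^ p * cos x ^ n) a b.
Proof.
  apply (ex_RInt_continuous (V := R_CompleteNormedModule)). intros x _.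
  apply (ex_derive_continuous (K := R_AbsRing) (V := R_NormedModule)).
  auto_derive; trivial.
Qed.

Lemma is_RInt_cos_moment (p n : nat) :
  is_RInt (fun x => x ^ p * cos x ^ (2 * n)) 0 (PI / 2) (cos_moment p n).
Proof. apply (RInt_correct (V := R_CompleteNormedModule)), ex_RInt_pow_cos. Qed.

Lemma cos_moment_0_S n :
  (2 * INR n + 2) * cos_moment 0 (S n) = (2 * INR n + 1) * cos_moment 0 n.
Proof.
  assert (H : is_RInt (fun x => (2 * INR n + 2) * (x ^ 0 * cos x ^ (2 * S n))
                - (2 * INR n + 1) * (x ^ 0 * cos x ^ (2 * n))) 0 (PI / 2) 0).
  { replace 0 with (minus (sin (PI / 2) * cos (PI / 2) ^ (2 * n + 1))
                          (sin 0 * cos 0 ^ (2 * n + 1))) at 2.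
    2:{ rewrite cos_PI2, sin_0, pow_i by lia. unfold minus, plus, opp; simpl. ring. }
    apply (is_RInt_derive (fun x => sin x * cos x ^ (2 * n + 1))).
    - intros x _. auto_derive; trivial.
      change (n + (n + 0))%nat with (2 * n)%nat.
      replace (pred (2 * n + 1)) with (2 * n)%nat by lia.
      replace (2 * S n)%nat with (2 * n + 2)%nat by lia.
      rewrite !pow_add, !plus_INR, mult_INR. simpl (INR 2); simpl (INR 1).
      assert (Hx : sin x * sin x = 1 - cos x * cos x)
        by (generalize (sin2_cos2 x); unfold Rsqr; lra).
      ring [Hx].
    - intros x _. apply (ex_derive_continuous (K := R_AbsRing) (V := R_NormedModule)).
      auto_derive; trivial. }
  assert (H' := is_RInt_minus _ _ _ _ _ _
    (is_RInt_scal _ _ _ (2 * INR n + 2) _ (is_RInt_cos_moment 0 (S n)))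
    (is_RInt_scal _ _ _ (2 * INR n + 1) _ (is_RInt_cos_moment 0 n))).
  apply (is_RInt_unique (V := R_CompleteNormedModule)) in H.
  apply (is_RInt_unique (V := R_CompleteNormedModule)) in H'.
  unfold minus, plus, opp, scal in H'; simpl in H'; unfold mult in H'; simpl in H'.
  simpl in H. unfold Rminus in H. rewrite H in H'. lra.
Qed.

Lemma cos_moment_SS p n :
  (INR p + 1) * (INR p + 2) * cos_moment p (S n)
  = (2 * INR n + 2) * ((2 * INR n + 1) * cos_moment (p + 2) n
                       - (2 * INR n + 2) * cos_moment (p + 2) (S n)).
Proof.
  (* [F] collects the boundary terms of two integrations by parts. On differentiation the mixed
     terms in x^(p+1) sin x cos^(2n+1) x cancel, and [F] vanishes at both ends. *)
  set (F := fun x => (INR p + 2) * (x ^ (p + 1) * cos x ^ (2 * n + 2))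
                     + (2 * INR n + 2) * (x ^ (p + 2) * (sin x * cos x ^ (2 * n + 1)))).
  assert (H : is_RInt (fun x =>
     (INR p + 1) * (INR p + 2) * (x ^ p * cos x ^ (2 * S n))
     - ((2 * INR n + 2) * (2 * INR n + 1) * (x ^ (p + 2) * cos x ^ (2 * n))
        - (2 * INR n + 2) * (2 * INR n + 2) * (x ^ (p + 2) * cos x ^ (2 * S n))))
     0 (PI / 2) 0).
  { replace 0 with (minus (F (PI / 2)) (F 0)) at 2.
    2:{ unfold F. rewrite cos_PI2, sin_0, !(pow_i _) by lia.
        unfold minus, plus, opp; simpl. ring. }
    apply (is_RInt_derive F).
    - intros x _. unfold F. auto_derive; trivial.
      change (n + (n + 0))%nat with (2 * n)%nat.
      replace (pred (p + 1)) with p by lia.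
      replace (pred (p + 2)) with (p + 1)%nat by lia.
      replace (pred (2 * n + 1)) with (2 * n)%nat by lia.
      replace (pred (2 * n + 2)) with (2 * n + 1)%nat by lia.
      replace (2 * S n)%nat with (2 * n + 2)%nat by lia.
      rewrite !pow_add, !plus_INR, mult_INR. simpl (INR 2); simpl (INR 1).
      assert (Hx : sin x * sin x = 1 - cos x * cos x)
        by (generalize (sin2_cos2 x); unfold Rsqr; lra).
      ring [Hx].
    - intros x _. apply (ex_derive_continuous (K := R_AbsRing) (V := R_NormedModule)).
      auto_derive; trivial. }
  assert (H' := is_RInt_minus _ _ _ _ _ _
    (is_RInt_scal _ _ _ ((INR p + 1) * (INR p + 2)) _ (is_RInt_cos_moment p (S n)))
    (is_RInt_minus _ _ _ _ _ _
    (is_RInt_scal _ _ _ ((2 * INR n + 2) * (2 * INR n + 1)) _ (is_RInt_cos_moment (p + 2) n))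
    (is_RInt_scal _ _ _ ((2 * INR n + 2) * (2 * INR n + 2)) _ (is_RInt_cos_moment (p + 2) (S n))))).
  apply (is_RInt_unique (V := R_CompleteNormedModule)) in H.
  apply (is_RInt_unique (V := R_CompleteNormedModule)) in H'.
  unfold minus, plus, opp, scal in H'; simpl in H'; unfold mult in H'; simpl in H'.
  simpl in H. unfold Rminus in H. rewrite H in H'. lra.
Qed.

Lemma cos_moment_pos n : 0 < cos_moment 0 n.
Proof.
  induction n as [|n IH].
  - unfold cos_moment. rewrite (RInt_ext _ (fun _ => 1)) by (intros; simpl; ring).
    rewrite RInt_const. unfold scal; simpl; unfold mult; simpl.
    generalize PI_RGT_0; lra.
  - assert (H := cos_moment_0_S n). assert (Hn := pos_INR n).
    apply Rmult_lt_reg_l with (2 * INR n + 2); [lra|]. rewrite H, Rmult_0_r.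
    apply Rmult_lt_0_compat; lra.
Qed.

Lemma cos_moment_nonneg p n : 0 <= cos_moment p n.
Proof.
  assert (HP := PI_RGT_0).
  apply RInt_ge_0; [lra|apply ex_RInt_pow_cos|].
  intros x Hx. apply Rmult_le_pos; [apply pow_le; lra|].
  rewrite pow_mult. apply pow_le, pow2_ge_0.
Qed.

Lemma mul_cos_le_sin x : 0 <= x <= PI -> x * cos x <= sin x.
Proof.
  intros Hx.
  destruct (Req_dec x 0) as [->|H0]; [rewrite sin_0; lra|].
  destruct (MVT_cor2 (fun t => sin t - t * cos t) (fun t => t * sin t) 0 x)
    as [c [Hc Hc']]; [lra| |].
  - intros c _. apply is_derive_Reals. auto_derive; trivial. ring.
  - rewrite sin_0 in Hc. assert (0 <= sin c) by (apply sin_ge_0; lra).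
    assert (0 <= c * sin c * (x - 0)) by (repeat apply Rmult_le_pos; lra). lra.
Qed.

(* [x cos x <= sin x] gives [x^2 cos^(2n+2) <= (1 - cos^2) cos^(2n)]. *)
Lemma cos_moment_2_le n : cos_moment 2 (S n) <= cos_moment 0 n - cos_moment 0 (S n).
Proof.
  assert (HP := PI_RGT_0).
  assert (H' := is_RInt_minus _ _ _ _ _ _
    (is_RInt_cos_moment 0 n) (is_RInt_cos_moment 0 (S n))).
  assert (E : cos_moment 0 n - cos_moment 0 (S n)
     = RInt (fun x => minus (x ^ 0 * cos x ^ (2 * n)) (x ^ 0 * cos x ^ (2 * S n))) 0 (PI / 2)).
  { symmetry. apply (is_RInt_unique (V := R_CompleteNormedModule)). exact H'. }
  rewrite E. apply RInt_le; [lra|apply ex_RInt_pow_cos|eexists; exact H'|].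
  intros x Hx.
  replace (2 * S n)%nat with (2 * n + 2)%nat by lia.
  unfold minus, plus, opp; simpl (_ + _). rewrite pow_add.
  assert (Hc : 0 <= cos x ^ (2 * n)) by (rewrite pow_mult; apply pow_le, pow2_ge_0).
  assert (Hs : (x * cos x) ^ 2 <= sin x ^ 2).
  { apply pow_incr; split; [apply Rmult_le_pos; [lra|apply cos_ge_0; lra]|].
    apply mul_cos_le_sin; lra. }
  generalize (sin2_cos2 x); unfold Rsqr; intros H2.
  apply (Rmult_le_compat_l _ _ _ Hc) in Hs.
  assert (E2 : sin x ^ 2 = 1 - cos x * cos x) by (simpl; lra).
  rewrite E2 in Hs. simpl in Hs |- *. lra.
Qed.

Lemma cos_moment_4_le n : cos_moment 4 n <= (PI / 2) ^ 2 * cos_moment 2 n.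
Proof.
  assert (HP := PI_RGT_0).
  assert (H' := is_RInt_scal _ _ _ ((PI / 2) ^ 2) _ (is_RInt_cos_moment 2 n)).
  assert (E : (PI / 2) ^ 2 * cos_moment 2 n
     = RInt (fun x => scal ((PI / 2) ^ 2) (x ^ 2 * cos x ^ (2 * n))) 0 (PI / 2)).
  { symmetry. apply (is_RInt_unique (V := R_CompleteNormedModule)). exact H'. }
  rewrite E.
  apply RInt_le; [lra|apply ex_RInt_pow_cos|eexists; exact H'|].
  intros x Hx.
  assert (Hc : 0 <= cos x ^ (2 * n)) by (rewrite pow_mult; apply pow_le, pow2_ge_0).
  assert (Hs : x ^ 2 <= (PI / 2) ^ 2) by (apply pow_incr; lra).
  apply (Rmult_le_compat_r (x ^ 2 * cos x ^ (2 * n))) in Hs.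
  - unfold scal; simpl; unfold mult; simpl in *. lra.
  - apply Rmult_le_pos; [apply pow2_ge_0|assumption].
Qed.

Lemma cos_moment_at_0 p : cos_moment p 0 = (PI / 2) ^ (S p) / INR (S p).
Proof.
  apply (is_RInt_unique (V := R_CompleteNormedModule)).
  replace ((PI / 2) ^ S p / INR (S p))
    with (minus ((PI / 2) ^ S p / INR (S p)) (0 ^ S p / INR (S p))).
  2:{ rewrite pow_i by lia. unfold minus, plus, opp, Rdiv; simpl plus; simpl opp.
      change ((PI / 2) ^ S p * / INR (S p) + - (0 * / INR (S p)) = (PI / 2) ^ S p * / INR (S p)).
      ring. }
  apply (is_RInt_derive (fun x => x ^ S p / INR (S p))).
  - intros x _. auto_derive; trivial. simpl pred. simpl (2 * 0)%nat.
    rewrite pow_O. field. apply (not_0_INR (S p)); lia.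
  - intros x _. apply (ex_derive_continuous (K := R_AbsRing) (V := R_NormedModule)).
    auto_derive; trivial.
Qed.

(** Dividing by the Wallis integral turns the two-term recurrences, whose coefficients differ, into
    plain differences. *)
Definition cos_ratio (p n : nat) : R := cos_moment p n / cos_moment 0 n.

(** In [cos_moment_SS] with [p = 0] the left side is itself a Wallis integral, so no integral
    survives in the quotient. *)
Lemma cos_ratio_2_step n :
  cos_ratio 2 n - cos_ratio 2 (S n) = / 2 * / INR (S n) ^ 2.
Proof.
  unfold cos_ratio. rewrite S_INR.
  assert (H1 := cos_moment_pos n). assert (H2 := cos_moment_pos (S n)).
  assert (H3 := cos_moment_0_S n). assert (H4 := cos_moment_SS 0 n).
  assert (Hn := pos_INR n). simpl (0 + 2)%nat in H4. simpl (INR 0) in H4.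
  assert (E : cos_moment 0 n = (2 * INR n + 2) * cos_moment 0 (S n) / (2 * INR n + 1)).
  { rewrite H3. field. lra. }
  rewrite E.
  transitivity (((2 * INR n + 1) * cos_moment 2 n - (2 * INR n + 2) * cos_moment 2 (S n))
     / ((2 * INR n + 2) * cos_moment 0 (S n))); [field; lra|].
  replace ((2 * INR n + 1) * cos_moment 2 n - (2 * INR n + 2) * cos_moment 2 (S n))
    with (2 * cos_moment 0 (S n) / (2 * INR n + 2)).
  { field. lra. }
  transitivity ((0 + 1) * (0 + 2) * cos_moment 0 (S n) / (2 * INR n + 2));
    [field; lra|]. rewrite H4. field; lra.
Qed.

Lemma cos_ratio_4_step n :
  cos_ratio 4 n - cos_ratio 4 (S n) = 3 * cos_ratio 2 (S n) / INR (S n) ^ 2.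
Proof.
  unfold cos_ratio. rewrite S_INR.
  assert (H1 := cos_moment_pos n). assert (H2 := cos_moment_pos (S n)).
  assert (H3 := cos_moment_0_S n). assert (H4 := cos_moment_SS 2 n).
  assert (Hn := pos_INR n). simpl (2 + 2)%nat in H4. simpl (INR 2) in H4.
  assert (E : cos_moment 0 n = (2 * INR n + 2) * cos_moment 0 (S n) / (2 * INR n + 1)).
  { rewrite H3. field. lra. }
  rewrite E.
  transitivity (((2 * INR n + 1) * cos_moment 4 n - (2 * INR n + 2) * cos_moment 4 (S n))
     / ((2 * INR n + 2) * cos_moment 0 (S n))); [field; lra|].
  replace ((2 * INR n + 1) * cos_moment 4 n - (2 * INR n + 2) * cos_moment 4 (S n))
    with (12 * cos_moment 2 (S n) / (2 * INR n + 2)).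
  { field. lra. }
  transitivity ((1 + 1 + 1) * (1 + 1 + 2) * cos_moment 2 (S n) / (2 * INR n + 2));
    [field; lra|]. rewrite H4. field; lra.
Qed.

Lemma is_lim_seq_inv_INR : is_lim_seq (fun n => / INR n) 0.
Proof.
  apply (is_lim_seq_inv _ p_infty); [apply is_lim_seq_INR|discriminate].
Qed.

(** By the Wallis recurrence the upper bound in [cos_moment_2_le] is
    [cos_moment 0 (S n) / (2n + 1)], so the ratio is at most 1/(2n+1), weakened here to 1/(n+1). *)
Lemma cos_ratio_2_lim : is_lim_seq (cos_ratio 2) 0.
Proof.
  apply is_lim_seq_incr_1.
  apply is_lim_seq_le_le with (u := fun _ => 0) (w := fun n => / INR (S n)).
  - intros n. unfold cos_ratio. split.
    + apply Rdiv_le_0_compat; [apply cos_moment_nonneg|apply cos_moment_pos].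
    + assert (H1 := cos_moment_2_le n). assert (H2 := cos_moment_0_S n).
      assert (H3 := cos_moment_pos (S n)). assert (Hn := pos_INR n).
      apply Rmult_le_reg_r with (cos_moment 0 (S n)); [assumption|].
      unfold Rdiv. rewrite Rmult_assoc, Rinv_l, Rmult_1_r by lra.
      rewrite S_INR. apply Rmult_le_reg_l with (INR n + 1); [lra|].
      rewrite <- Rmult_assoc, Rinv_r, Rmult_1_l by lra.
      assert ((2 * INR n + 1) * (cos_moment 0 n - cos_moment 0 (S n)) = cos_moment 0 (S n)) by lra.
      assert ((INR n + 1) * cos_moment 2 (S n) <= (INR n + 1) * (cos_moment 0 n - cos_moment 0 (S n)))
        by (apply Rmult_le_compat_l; lra).
      assert (0 <= INR n * (cos_moment 0 n - cos_moment 0 (S n))).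
      { apply Rmult_le_pos; [lra|]. assert (0 <= cos_moment 2 (S n)) by apply cos_moment_nonneg. lra. }
      lra.
  - apply is_lim_seq_const.
  - apply (is_lim_seq_incr_1 (fun n => / INR n)), is_lim_seq_inv_INR.
Qed.

Lemma cos_ratio_4_lim : is_lim_seq (cos_ratio 4) 0.
Proof.
  apply is_lim_seq_le_le with (u := fun _ => 0) (w := fun n => (PI / 2) ^ 2 * cos_ratio 2 n).
  - intros n. unfold cos_ratio. assert (H := cos_moment_pos n). split.
    + apply Rdiv_le_0_compat; [apply cos_moment_nonneg|apply cos_moment_pos].
    + unfold Rdiv at 1 3. rewrite <- Rmult_assoc. apply Rmult_le_compat_r.
      * left; now apply Rinv_0_lt_compat.
      * apply cos_moment_4_le.
  - apply is_lim_seq_const.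
  - replace (Finite 0) with (Rbar_mult ((PI / 2) ^ 2) 0)
      by (simpl; now rewrite Rmult_0_r).
    apply is_lim_seq_scal_l, cos_ratio_2_lim.
Qed.

Lemma is_series_telescope (a x : nat -> R) :
  (forall n, a n = x n - x (S n)) -> is_lim_seq x 0 -> is_series a (x 0%nat).
Proof.
  intros Ha Hx. change (is_lim_seq (sum_n a) (x 0%nat)).
  apply (is_lim_seq_ext (fun n => x 0%nat - x (S n))).
  - intros n. rewrite sum_n_Reals. induction n as [|n IH]; simpl; rewrite Ha; lra.
  - replace (Finite (x 0%nat)) with (Finite (x 0%nat - 0)) by (f_equal; ring).
    apply is_lim_seq_minus'; [apply is_lim_seq_const|].
    now apply (is_lim_seq_incr_1 x).
Qed.

Lemma is_series_inv_sq : is_series (fun n => / INR (S n) ^ 2) (PI ^ 2 / 6).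
Proof.
  assert (H := PI_RGT_0).
  replace (PI ^ 2 / 6) with (2 * cos_ratio 2 0).
  2:{ unfold cos_ratio. rewrite !cos_moment_at_0. simpl. field. lra. }
  apply (is_series_telescope _ (fun n => 2 * cos_ratio 2 n)).
  - intros n. rewrite <- Rmult_minus_distr_l, cos_ratio_2_step. field.
    apply not_0_INR; lia.
  - replace (Finite 0) with (Rbar_mult 2 0) by (simpl; now rewrite Rmult_0_r).
    apply is_lim_seq_scal_l, cos_ratio_2_lim.
Qed.

(* With [j = cos_ratio 2], the step [3 j_{n+1} / (n+1)^2] of [cos_ratio 4] is completed,
   by [j_n - j_{n+1} = 1 / (2 (n+1)^2)], to a difference of squares, so the double sum for [zeta 4] telescopes. *)
Lemma is_series_inv_pow4 : is_series (fun n => / INR (S n) ^ 4) (PI ^ 4 / 90).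
Proof.
  assert (H := PI_RGT_0).
  (* The factor 4 turns the square of the step 1/(2(n+1)^2) into 1/(n+1)^4; the factor 4/3 then
     cancels the cross term. *)
  set (x := fun n => 4 * cos_ratio 2 n ^ 2 - 4 / 3 * cos_ratio 4 n).
  replace (PI ^ 4 / 90) with (x 0%nat).
  2:{ unfold x, cos_ratio. rewrite !cos_moment_at_0. simpl. field. lra. }
  apply is_series_telescope.
  - intros n. unfold x.
    assert (H2 := cos_ratio_2_step n). assert (H4 := cos_ratio_4_step n).
    replace (cos_ratio 4 n) with (cos_ratio 4 (S n) + 3 * cos_ratio 2 (S n) / INR (S n) ^ 2) by lra.
    replace (cos_ratio 2 n) with (cos_ratio 2 (S n) + / 2 * / INR (S n) ^ 2) by lra.
    field. apply not_0_INR; lia.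
  - unfold x. replace (Finite 0) with (Finite (4 * 0 ^ 2 - 4 / 3 * 0)) by (f_equal; simpl; lra).
    apply is_lim_seq_minus'.
    + apply is_lim_seq_mult'; [apply is_lim_seq_const|]. simpl.
      apply is_lim_seq_mult'; [apply cos_ratio_2_lim|].
      apply is_lim_seq_mult'; [apply cos_ratio_2_lim|apply is_lim_seq_const].
    + apply is_lim_seq_mult'; [apply is_lim_seq_const|apply cos_ratio_4_lim].
Qed.

(** * Convolution of sequences of order [1/n^2] *)

Lemma is_lim_seq_bound (u : nat -> R) (l : R) :
  is_lim_seq u l -> exists M, 0 < M /\ forall n, Rabs (u n) <= M.
Proof.
  intros H. apply is_lim_seq_Reals in H.
  destruct (maj_by_pos u) as [M [HM HM']]; [now exists l|].
  exists M; split; [assumption|]. intros n; apply HM'.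
Qed.

Lemma lim_sq_bound (a : fps) (A : R) :
  is_lim_seq (fun n => INR n ^ 2 * a n) A ->
  exists K, 0 < K /\ forall n, Rabs (a n) <= K * / INR (S n) ^ 2.
Proof.
  intros H. destruct (is_lim_seq_bound _ _ H) as [M [HM HM']].
  assert (H0 := Rabs_pos (a 0%nat)).
  (* The hypothesis does not control [a 0], hence the second summand; the 4 comes from (n+2)^2 <= 4
     (n+1)^2. *)
  exists (4 * M + Rabs (a 0%nat)). split; [lra|].
  intros [|n]; [simpl; lra|].
  assert (Hn := pos_INR n). specialize (HM' (S n)).
  rewrite Rabs_mult, Rabs_pos_eq in HM' by apply pow2_ge_0.
  apply Rmult_le_reg_r with (INR (S (S n)) ^ 2); [apply pow_lt, lt_0_INR; lia|].
  rewrite Rmult_assoc, Rinv_l, Rmult_1_r by (apply pow_nonzero, not_0_INR; lia).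
  rewrite !S_INR in *. assert (Ha := Rabs_pos (a (S n))).
  assert ((INR n + 1 + 1) ^ 2 <= 4 * (INR n + 1) ^ 2) by nra.
  assert (Rabs (a (S n)) * (INR n + 1 + 1) ^ 2 <= Rabs (a (S n)) * (4 * (INR n + 1) ^ 2))
    by (now apply Rmult_le_compat_l).
  lra.
Qed.

Lemma ex_series_Rabs_le (a : fps) (b : nat -> R) :
  (forall n, Rabs (a n) <= b n) -> ex_series b -> ex_series (fun n => Rabs (a n)).
Proof.
  intros H Hb. apply (ex_series_le (V := R_CompleteNormedModule) _ b); [|assumption].
  intros n. unfold norm; simpl. unfold abs; simpl. now rewrite Rabs_Rabsolu.
Qed.

Lemma lim_sq_abs_summable (a : fps) (A : R) :
  is_lim_seq (fun n => INR n ^ 2 * a n) A -> ex_series (fun n => Rabs (a n)).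
Proof.
  intros H. destruct (lim_sq_bound _ _ H) as [K [_ HK]].
  apply ex_series_Rabs_le with (1 := HK).
  apply (ex_series_scal_l (K := R_AbsRing) (V := R_NormedModule)).
  eexists; apply is_series_inv_sq.
Qed.

Lemma is_lim_seq_fps_mul_finite N (a b : fps) :
  (forall n, (N <= n)%nat -> a n = 0) -> is_lim_seq b 0 ->
  is_lim_seq (PS_mult a b) 0.
Proof.
  intros Ha Hb. revert a Ha. induction N as [|N IH]; intros a Ha.
  - apply (is_lim_seq_ext (fun _ => 0)); [|apply is_lim_seq_const].
    intros n. unfold PS_mult. rewrite (sum_eq _ (fun _ => 0)), sum_cte; [ring|].
    intros i _. rewrite Ha by lia. ring.
  - apply is_lim_seq_incr_1.
    apply (is_lim_seq_ext (fun n => a 0%nat * b (S n) + PS_mult (fun k => a (S k)) b n)).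
    { intros n. now rewrite fps_mul_S_l. }
    replace (Finite 0) with (Finite (a 0%nat * 0 + 0)) by (f_equal; ring).
    apply is_lim_seq_plus'.
    + apply is_lim_seq_mult'; [apply is_lim_seq_const|].
      now apply (is_lim_seq_incr_1 b).
    + apply IH. intros n Hn. apply Ha. lia.
Qed.

Lemma sum_Rabs_le_Series (b : fps) n :
  ex_series (fun n => Rabs (b n)) ->
  sum_f_R0 (fun k => Rabs (b k)) n <= Series (fun n => Rabs (b n)).
Proof.
  intros Hb. apply sum_incr.
  - apply is_series_Reals. now apply Series_correct.
  - intros; apply Rabs_pos.
Qed.

Lemma fps_mul_abs_le (a b : fps) n :
  Rabs (PS_mult a b n) <= PS_mult (fun k => Rabs (a k)) (fun k => Rabs (b k)) n.
Proof.
  unfold PS_mult. eapply Rle_trans; [apply sum_f_R0_triangle|].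
  right. apply sum_eq; intros. apply Rabs_mult.
Qed.

Lemma fps_mul_le (a a' b b' : fps) n :
  (forall k, 0 <= a k <= a' k) -> (forall k, 0 <= b k <= b' k) ->
  PS_mult a b n <= PS_mult a' b' n.
Proof.
  intros Ha Hb. apply sum_Rle. intros k _.
  apply Rmult_le_compat; try apply Ha; apply Hb.
Qed.

(** Cut [y] at an index N: the head contributes finitely many shifts of [b], which tend to 0, and
    the rest is small times the absolute sum of [b]. *)
Lemma is_lim_seq_fps_mul_0 (y b : fps) :
  is_lim_seq y 0 -> ex_series (fun n => Rabs (b n)) ->
  is_lim_seq (PS_mult y b) 0.
Proof.
  intros Hy Hb. set (B := Series (fun n => Rabs (b n)) + 1).
  assert (HB : 0 < B).
  { unfold B. assert (H := sum_Rabs_le_Series b 0 Hb). simpl in H.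
    assert (H' := Rabs_pos (b 0%nat)). lra. }
  apply is_lim_seq_spec. intros eps.
  assert (He : 0 < eps / (2 * B)) by (apply Rdiv_lt_0_compat; [apply cond_pos|lra]).
  apply is_lim_seq_spec in Hy. destruct (Hy (mkposreal _ He)) as [N HN]. simpl in HN.
  set (y1 := fun n => if le_lt_dec N n then 0 else y n).
  set (y2 := fun n => if le_lt_dec N n then y n else 0).
  assert (Ey : y = (y1 + y2)%fps).
  { apply functional_extensionality; intros n. unfold fps_add, y1, y2.
    destruct (le_lt_dec N n); ring. }
  assert (H1 : is_lim_seq (PS_mult y1 b) 0).
  { apply is_lim_seq_fps_mul_finite with N.
    - intros n Hn. unfold y1. destruct (le_lt_dec N n); [reflexivity|lia].
    - now apply ex_series_lim_0, ex_series_Rabs. }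
  apply is_lim_seq_spec in H1.
  destruct (H1 (pos_div_2 eps)) as [N1 HN1]. simpl in HN1.
  exists N1. intros n Hn. specialize (HN1 n Hn).
  rewrite Rminus_0_r in *. rewrite Ey, fps_mulDl. unfold fps_add at 1.
  assert (H2 : Rabs (PS_mult y2 b n) <= eps / 2).
  { eapply Rle_trans; [apply fps_mul_abs_le|].
    eapply Rle_trans.
    { apply fps_mul_le with (a' := fun _ => eps / (2 * B)) (b' := fun k => Rabs (b k)).
      - intros k. split; [apply Rabs_pos|]. unfold y2. destruct (le_lt_dec N k).
        + specialize (HN k l). rewrite Rminus_0_r in HN. lra.
        + rewrite Rabs_R0. lra.
      - intros k. split; [apply Rabs_pos|lra]. }
    rewrite fps_mulC. unfold PS_mult. rewrite <- scal_sum.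
    assert (H := sum_Rabs_le_Series b n Hb).
    replace (eps / 2) with (eps / (2 * B) * B) by (field; lra).
    apply Rmult_le_compat_l; [lra|]. unfold B; lra. }
  eapply Rle_lt_trans; [apply Rabs_triang|]. lra.
Qed.

(** Split [x] into its limit and a null sequence: the constant [X] contributes [X] times the partial
    sums of [b]. *)
Lemma is_lim_seq_fps_mul (x b : fps) (X t : R) :
  is_lim_seq x X -> is_series b t -> ex_series (fun n => Rabs (b n)) ->
  is_lim_seq (PS_mult x b) (X * t).
Proof.
  intros Hx Hs Hb.
  apply (is_lim_seq_ext (fun n => X * sum_n b n + PS_mult (fun k => x k - X) b n)).
  - intros n. rewrite sum_n_Reals. unfold PS_mult.
    replace (sum_f_R0 b n) with (sum_f_R0 (fun k => b (n - k)%nat) n).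
    + rewrite scal_sum, <- sum_plus. apply sum_eq; intros; ring.
    (* Reversing the order of summation is commutativity of the product with the constant sequence
       1. *)
    + assert (H := f_equal (fun f => f n) (fps_mulC (fun _ => 1) b)).
      unfold PS_mult in H.
      rewrite (sum_eq _ (fun k => 1 * b (n - k)%nat)) by (intros; ring).
      rewrite H. apply sum_eq; intros; ring.
  - replace (Finite (X * t)) with (Finite (X * t + 0)) by (f_equal; ring).
    apply is_lim_seq_plus'.
    + apply is_lim_seq_mult'; [apply is_lim_seq_const|exact Hs].
    + apply is_lim_seq_fps_mul_0; [|assumption].
      replace (Finite 0) with (Finite (X - X)) by (f_equal; ring).
      apply is_lim_seq_minus'; [assumption|apply is_lim_seq_const].
Qed.

(** Partial fractions: 1/((k+1)(n-k+1)) is 1/(n+2) times the sum of 1/(k+1) and 1/(n-k+1), and the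
    two sums agree by reversal. *)
Lemma sum_inv_mul_inv n :
  PS_mult (fun k => / INR (S k)) (fun k => / INR (S k)) n
  = 2 / INR (S (S n)) * sum_f_R0 (fun k => / INR (S k)) n.
Proof.
  assert (H := f_equal (fun f => f n) (fps_mulC (fun _ => 1) (fun k => / INR (S k)))).
  unfold PS_mult in *.
  replace (2 / INR (S (S n)) * sum_f_R0 (fun k => / INR (S k)) n) with
    (/ INR (S (S n)) * (sum_f_R0 (fun k => / INR (S k) * 1) n
        + sum_f_R0 (fun k => 1 * / INR (S (n - k))) n)).
  - rewrite <- sum_plus, scal_sum. apply sum_eq; intros k Hk.
    rewrite !S_INR, minus_INR by assumption.
    assert (H1 := pos_INR k). assert (H2 := le_INR _ _ Hk). field. lra.
  - rewrite H. rewrite (sum_eq (fun k => / INR (S k) * 1) (fun k => / INR (S k))) by (intros; ring).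
    unfold Rdiv. ring.
Qed.

(** The convolution is of order log n / n. Cesaro's theorem for 1/(k+1) gives the limit without any
    estimate of harmonic numbers. *)
Lemma is_lim_seq_fps_mul_inv (a b : fps) (K L : R) :
  (forall n, Rabs (a n) <= K * / INR (S n)) ->
  (forall n, Rabs (b n) <= L * / INR (S n)) ->
  is_lim_seq (PS_mult a b) 0.
Proof.
  intros Ha Hb. apply is_lim_seq_abs_0.
  set (h := fun k => / INR (S k)).
  assert (Hh : is_lim_seq h 0)
    by apply (is_lim_seq_incr_1 (fun k => / INR k)), is_lim_seq_inv_INR.
  assert (HC : is_lim_seq (fun n => sum_f_R0 h n / INR (S n)) 0).
  { apply is_lim_seq_Reals, Cesaro_1, is_lim_seq_Reals, is_lim_seq_incr_1 in Hh.
    exact Hh. }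
  apply is_lim_seq_le_le with (u := fun _ => 0)
    (w := fun n => K * L * 2 * (sum_f_R0 h n / INR (S n))).
  - intros n. split; [apply Rabs_pos|].
    eapply Rle_trans; [apply fps_mul_abs_le|].
    eapply Rle_trans.
    { apply fps_mul_le with (a' := fun k => K * h k) (b' := fun k => L * h k);
        intros k; split; try apply Rabs_pos; [apply Ha|apply Hb]. }
    rewrite fps_mul_scal, fps_mulC, fps_mul_scal, sum_inv_mul_inv.
    fold h. rewrite !Rmult_assoc.
    assert (HK : 0 <= K).
    { specialize (Ha 0%nat). assert (H0 := Rabs_pos (a 0%nat)). simpl in Ha. lra. }
    assert (HL : 0 <= L).
    { specialize (Hb 0%nat). assert (H0 := Rabs_pos (b 0%nat)). simpl in Hb. lra. }
    apply Rmult_le_compat_l; [assumption|]. apply Rmult_le_compat_l; [assumption|].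
    unfold Rdiv. rewrite Rmult_assoc. apply Rmult_le_compat_l; [lra|].
    rewrite Rmult_comm. apply Rmult_le_compat_l.
    + apply cond_pos_sum. intros k. left. apply Rinv_0_lt_compat, lt_0_INR; lia.
    + apply Rinv_le_contravar; [apply lt_0_INR; lia|apply le_INR; lia].
  - apply is_lim_seq_const.
  - replace (Finite 0) with (Finite (K * L * 2 * 0)) by (f_equal; ring).
    apply is_lim_seq_mult'; [apply is_lim_seq_const|exact HC].
Qed.

(* The pairs [(A, s)] multiply like dual numbers [s + A eps]. *)
Definition sq_asymp (a : fps) (A s : R) : Prop :=
  is_lim_seq (fun n => INR n ^ 2 * a n) A /\ is_series a s.

Lemma theta_bound (a : fps) (A : R) :
  is_lim_seq (fun n => INR n ^ 2 * a n) A ->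
  exists K, forall n, Rabs (theta a n) <= K * / INR (S n).
Proof.
  intros H. destruct (lim_sq_bound _ _ H) as [K [HK HK']].
  exists K. intros n. unfold theta. rewrite Rabs_mult, Rabs_pos_eq by apply pos_INR.
  assert (Hn := lt_0_INR (S n) (Nat.lt_0_succ n)).
  apply Rle_trans with (INR (S n) * (K * / INR (S n) ^ 2)).
  - apply Rmult_le_compat; [apply pos_INR|apply Rabs_pos|apply le_INR; lia|apply HK'].
  - right. field. lra.
Qed.

(** Multiplying by n^2 is [theta] twice, and [theta] is a derivation. The outer terms of the Leibniz
    rule are a convergent sequence against a summable one; the middle ones convolve two sequences of
    order 1/n and vanish in the limit. *)
Lemma sq_asymp_mul (a b : fps) (A B s t : R) :
  sq_asymp a A s -> sq_asymp b B t ->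
  sq_asymp (a * b)%fps (A * t + s * B) (s * t).
Proof.
  intros [HA Hs] [HB Ht].
  assert (Ha := lim_sq_abs_summable _ _ HA). assert (Hb := lim_sq_abs_summable _ _ HB).
  split; [|now apply is_series_mult].
  assert (E : theta (theta (a * b)%fps)
    = (theta (theta a) * b + (theta a * theta b + theta a * theta b)
       + theta (theta b) * a)%fps).
  { rewrite !theta_mul, theta_add, !theta_mul. ring. }
  apply (is_lim_seq_ext (theta (theta (a * b)%fps))).
  { intros n. unfold theta. ring. }
  rewrite E.
  assert (HA' : is_lim_seq (theta (theta a)) A).
  { revert HA. apply is_lim_seq_ext. intros n; unfold theta; ring. }
  assert (HB' : is_lim_seq (theta (theta b)) B).
  { revert HB. apply is_lim_seq_ext. intros n; unfold theta; ring. }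
  destruct (theta_bound _ _ HA) as [K HK]. destruct (theta_bound _ _ HB) as [L HL].
  assert (H0 := is_lim_seq_fps_mul_inv _ _ _ _ HK HL).
  replace (Finite (A * t + s * B)) with (Finite (A * t + (0 + 0) + B * s))
    by (f_equal; ring).
  unfold fps_add.
  repeat apply is_lim_seq_plus'; try exact H0; now apply is_lim_seq_fps_mul.
Qed.

Lemma sq_asymp_sub (a b : fps) (A B s t : R) :
  sq_asymp a A s -> sq_asymp b B t -> sq_asymp (a - b)%fps (A - B) (s - t).
Proof.
  intros [HA Hs] [HB Ht]. split.
  - apply (is_lim_seq_ext (fun n => INR n ^ 2 * a n - INR n ^ 2 * b n)).
    { intros n; unfold fps_sub; ring. }
    now apply is_lim_seq_minus'.
  - now apply (is_series_minus (K := R_AbsRing) (V := R_NormedModule)).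
Qed.

Lemma is_series_finite (a : fps) N :
  (forall n, (N < n)%nat -> a n = 0) -> is_series a (sum_f_R0 a N).
Proof.
  intros H. apply (is_lim_seq_ext_loc (fun _ => sum_f_R0 a N) (sum_n a) (sum_f_R0 a N)).
  - exists N. intros n Hn. rewrite sum_n_Reals.
    induction Hn as [|n Hn IH]; [reflexivity|]. simpl. rewrite <- IH, H by lia. ring.
  - apply is_lim_seq_const.
Qed.

Lemma sq_asymp_finite (a : fps) N :
  (forall n, (N < n)%nat -> a n = 0) -> sq_asymp a 0 (sum_f_R0 a N).
Proof.
  intros H. split; [|now apply is_series_finite].
  apply (is_lim_seq_ext_loc (fun _ => 0)); [|apply is_lim_seq_const].
  exists (S N). intros n Hn. rewrite H by lia. ring.
Qed.

Lemma sq_asymp_const (c : R) : sq_asymp (fps_const c) 0 c.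
Proof. apply (sq_asymp_finite (fps_const c) 0). intros [|n] Hn; [lia|reflexivity]. Qed.

Lemma sq_asymp_X : sq_asymp fps_X 0 1.
Proof.
  replace 1 with (sum_f_R0 fps_X 1) by (simpl; ring).
  apply sq_asymp_finite. intros [|[|n]] Hn; [lia|lia|reflexivity].
Qed.

(** * Iterated tails of the series of [1/j^4] *)

Definition tail (a : nat -> R) (n : nat) : R := Series (fun k => a (n + k)%nat).

Lemma tail_step (a : nat -> R) n : ex_series a -> tail a n - tail a (S n) = a n.
Proof.
  intros H. unfold tail.
  rewrite (Series_incr_1 (fun k => a (n + k)%nat)) by now apply ex_series_incr_n.
  rewrite Nat.add_0_r.
  rewrite (Series_ext (fun k => a (n + S k)%nat) (fun k => a (S n + k)%nat)); [ring|].
  intros k. f_equal. lia.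
Qed.

Lemma tail_0 (a : nat -> R) : tail a 0 = Series a.
Proof. reflexivity. Qed.

Lemma sum_tail (a : nat -> R) n :
  ex_series a -> sum_f_R0 a n + tail a (S n) = Series a.
Proof.
  intros H. rewrite <- tail_0.
  induction n as [|n IH]; simpl; [|rewrite <- IH]; rewrite <- (tail_step a) by assumption; ring.
Qed.

Lemma tail_lim (a : nat -> R) : ex_series a -> is_lim_seq (tail a) 0.
Proof.
  intros H. apply is_lim_seq_incr_1.
  apply (is_lim_seq_ext (fun n => Series a - sum_n a n)).
  - intros n. rewrite sum_n_Reals. generalize (sum_tail a n H). lra.
  - replace (Finite 0) with (Finite (Series a - Series a)) by (f_equal; ring).
    apply is_lim_seq_minus'; [apply is_lim_seq_const|].
    exact (Series_correct _ H).
Qed.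

(** [y - x] is nonincreasing with limit 0, hence nonnegative. Applied to tails, this reduces an
    estimate to a rational inequality in n. *)
Lemma le_of_decrements_le (x y : nat -> R) :
  (forall n, x n - x (S n) <= y n - y (S n)) ->
  is_lim_seq x 0 -> is_lim_seq y 0 -> forall n, x n <= y n.
Proof.
  intros H Hx Hy n.
  assert (Hl : is_lim_seq (fun n => y n - x n) 0).
  { replace (Finite 0) with (Finite (0 - 0)) by (f_equal; ring).
    now apply is_lim_seq_minus'. }
  assert (H0 := is_lim_seq_decr_compare _ _ Hl).
  simpl in H0. specialize (H0 (fun k => ltac:(specialize (H k); lra)) n). lra.
Qed.

(** Summation by parts: [W] is the sequence of partial sums of [w], and the boundary term is
    [W n * tail a (S n)]. *)
Lemma sum_mul_tail (w W a : nat -> R) (s : R) :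
  W 0%nat = w 0%nat -> (forall n, W (S n) = W n + w (S n)) -> ex_series a ->
  is_lim_seq (fun n => W n * tail a (S n)) 0 ->
  is_series (fun n => W n * a n) s -> is_series (fun n => w n * tail a n) s.
Proof.
  intros H0 HS Ha Hl Hs.
  change (is_lim_seq (sum_n (fun n => w n * tail a n)) s).
  apply (is_lim_seq_ext (fun n => sum_n (fun n => W n * a n) n + W n * tail a (S n))).
  - intros n. rewrite !sum_n_Reals.
    induction n as [|n IH]; simpl.
    + rewrite H0, <- (tail_step a 0) by assumption. ring.
    + rewrite <- IH, HS, <- (tail_step a (S n)) by assumption. ring.
  - replace (Finite s) with (Finite (s + 0)) by (f_equal; ring).
    apply is_lim_seq_plus'; assumption.
Qed.

Lemma is_lim_seq_squeeze_inv (x : nat -> R) (l C : R) :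
  (forall n, Rabs (x (S n) - l) <= C * / INR (S n)) -> is_lim_seq x l.
Proof.
  intros H. apply is_lim_seq_incr_1.
  apply is_lim_seq_le_le with (u := fun n => l - C * / INR (S n))
    (w := fun n => l + C * / INR (S n)).
  - intros n. specialize (H n). apply Rabs_le_between in H. lra.
  - replace (Finite l) with (Finite (l - C * 0)) by (f_equal; ring).
    apply is_lim_seq_minus'; [apply is_lim_seq_const|].
    apply is_lim_seq_mult'; [apply is_lim_seq_const|].
    apply (is_lim_seq_incr_1 (fun n => / INR n)), is_lim_seq_inv_INR.
  - replace (Finite l) with (Finite (l + C * 0)) by (f_equal; ring).
    apply is_lim_seq_plus'; [apply is_lim_seq_const|].
    apply is_lim_seq_mult'; [apply is_lim_seq_const|].
    apply (is_lim_seq_incr_1 (fun n => / INR n)), is_lim_seq_inv_INR.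
Qed.

Definition inv_pow (p : nat) : fps := fun n => / INR (S n) ^ p.

Lemma ex_series_inv_pow p : (2 <= p)%nat -> ex_series (inv_pow p).
Proof.
  intros Hp.
  apply (ex_series_le (V := R_CompleteNormedModule) _ (fun n => / INR (S n) ^ 2));
    [|eexists; apply is_series_inv_sq].
  intros n. unfold norm; simpl norm; unfold abs; simpl abs; unfold inv_pow.
  assert (1 <= INR (S n)) by (apply (le_INR 1); lia).
  rewrite Rabs_pos_eq by (left; apply Rinv_0_lt_compat, pow_lt; lra).
  apply Rinv_le_contravar; [apply pow_lt; lra|now apply Rle_pow].
Qed.

Definition R4 : fps := tail (inv_pow 4).
(** The tail starts at [S n] because the coefficient of z^n in (mu - R)/(1 - z) is mu minus the sum
    of [R4] up to n. *)
Definition Q4 : fps := fun n => tail R4 (S n).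

Lemma R4_pos n : 0 < R4 n.
Proof.
  assert (H := ex_series_inv_pow 4 ltac:(lia)).
  assert (Hp : forall k, 0 < inv_pow 4 k).
  { intros k. apply Rinv_0_lt_compat, pow_lt, lt_0_INR; lia. }
  assert (H1 := tail_step (inv_pow 4) n H).
  assert (H2 : 0 <= tail (inv_pow 4) (S n)).
  { apply Rle_trans with (Series (fun k => 0 * inv_pow 4 (S n + k))).
    - rewrite Series_scal_l. lra.
    - apply Series_le; [|now apply (ex_series_incr_n (inv_pow 4) (S n))].
      intros k. assert (Hk := Hp (S n + k)%nat). lra. }
  specialize (Hp n). unfold R4. lra.
Qed.

Lemma is_lim_seq_inv_sq (c : R) : is_lim_seq (fun n => c / INR (S n) ^ 2) 0.
Proof.
  replace (Finite 0) with (Finite (c * 0)) by (f_equal; ring).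
  apply is_lim_seq_mult'; [apply is_lim_seq_const|].
  apply (ex_series_lim_0 (inv_pow 2)), ex_series_inv_pow; lia.
Qed.

(** A crude bound, used for the summability of [R4], on which [Q4_step] and [Q4_lim] rest. *)
Lemma R4_le n : R4 n <= 2 / INR (S n) ^ 2.
Proof.
  revert n. apply le_of_decrements_le.
  - intros n. unfold R4. rewrite tail_step by (apply ex_series_inv_pow; lia).
    unfold inv_pow. rewrite (S_INR (S n)).
    assert (Hn : 1 <= INR (S n)) by (apply (le_INR 1); lia). revert Hn.
    generalize (INR (S n)); intros t Ht.
    apply Rminus_le.
    replace (/ t ^ 4 - (2 / t ^ 2 - 2 / (t + 1) ^ 2))
      with (((t + 1) ^ 2 - (4 * t + 2) * t ^ 2) * / (t ^ 4 * (t + 1) ^ 2)) by (field; lra).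
    rewrite <- (Rmult_0_l (/ (t ^ 4 * (t + 1) ^ 2))). apply Rmult_le_compat_r.
    + left. apply Rinv_0_lt_compat, Rmult_lt_0_compat; apply pow_lt; lra.
    + nra.
  - apply tail_lim, ex_series_inv_pow; lia.
  - apply is_lim_seq_inv_sq.
Qed.

Lemma ex_series_R4 : ex_series R4.
Proof.
  apply (ex_series_le (V := R_CompleteNormedModule) _ (fun n => 2 * inv_pow 2 n)).
  - intros n. unfold norm; simpl norm; unfold abs; simpl abs.
    rewrite Rabs_pos_eq by (left; apply R4_pos). apply R4_le.
  - apply (ex_series_scal_l (K := R_AbsRing) (V := R_NormedModule)).
    apply ex_series_inv_pow; lia.
Qed.

Lemma Q4_step n : Q4 n - Q4 (S n) = R4 (S n).
Proof. apply tail_step, ex_series_R4. Qed.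

Lemma Q4_lim : is_lim_seq Q4 0.
Proof. apply (is_lim_seq_incr_1 (tail R4)), tail_lim, ex_series_R4. Qed.

Lemma R4_step n : R4 n - R4 (S n) = / INR (S n) ^ 4.
Proof. apply tail_step, ex_series_inv_pow; lia. Qed.

Lemma R4_lim : is_lim_seq R4 0.
Proof. apply tail_lim, ex_series_inv_pow; lia. Qed.

Lemma is_lim_seq_decrement (y : nat -> R) :
  is_lim_seq y 0 -> is_lim_seq (fun n => y n - y (S n)) 0.
Proof.
  intros H. replace (Finite 0) with (Finite (0 - 0)) by (f_equal; ring).
  apply is_lim_seq_minus'; [assumption|now apply (is_lim_seq_incr_1 y)].
Qed.

(** The function 1/(6 t^2) has second derivative 1/t^4, so its second difference centred at t + 1
    dominates 1/(t+1)^4. The bound is kept as a first difference so that comparing decrements once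
    more gives [Q4_le]. *)
Lemma R4_S_le n :
  R4 (S n) <= 1 / 6 / INR (S n) ^ 2 - 1 / 6 / INR (S (S n)) ^ 2.
Proof.
  revert n. apply le_of_decrements_le.
  - intros n. rewrite R4_step. rewrite !(S_INR (S _)).
    assert (Hn : 1 <= INR (S n)) by (apply (le_INR 1); lia). revert Hn.
    generalize (INR (S n)); intros t Ht.
    apply Rminus_le.
    (* With s = t + 1 the numerator is 3 - 5 s^2. *)
    replace (/ (t + 1) ^ 4 - (1 / 6 / t ^ 2 - 1 / 6 / (t + 1) ^ 2 -
       (1 / 6 / (t + 1) ^ 2 - 1 / 6 / (t + 1 + 1) ^ 2)))
      with ((3 * (t * (t + 2)) ^ 2 - (3 * (t + 1) ^ 2 - 1) * (t + 1) ^ 2)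
         * / (3 * ((t + 1) ^ 4 * t ^ 2 * (t + 1 + 1) ^ 2))) by (field; lra).
    rewrite <- (Rmult_0_l (/ (3 * ((t + 1) ^ 4 * t ^ 2 * (t + 1 + 1) ^ 2)))).
    apply Rmult_le_compat_r.
    + left. apply Rinv_0_lt_compat. repeat apply Rmult_lt_0_compat; try apply pow_lt; lra.
    + nra.
  - apply (is_lim_seq_incr_1 R4), R4_lim.
  - apply (is_lim_seq_decrement (fun n => 1 / 6 / INR (S n) ^ 2)), is_lim_seq_inv_sq.
Qed.

Lemma Q4_le n : Q4 n <= 1 / 6 / INR (S n) ^ 2.
Proof.
  revert n. apply le_of_decrements_le.
  - intros n. rewrite Q4_step. apply R4_S_le.
  - apply Q4_lim.
  - apply is_lim_seq_inv_sq.
Qed.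

Lemma is_lim_seq_inv_sq_succ : is_lim_seq (fun n => 1 / 6 / (INR (S n) ^ 2 + 1)) 0.
Proof.
  apply is_lim_seq_le_le with (u := fun _ => 0) (w := fun n => 1 / 6 / INR (S n) ^ 2).
  - intros n. assert (Hn : 0 < INR (S n) ^ 2) by (apply pow_lt, lt_0_INR; lia).
    split; [apply Rdiv_le_0_compat; lra|].
    apply Rmult_le_compat_l; [lra|]. apply Rinv_le_contravar; lra.
  - apply is_lim_seq_const.
  - apply is_lim_seq_inv_sq.
Qed.

(** Replacing t^2 by t^2 + 1 reverses the comparison of second differences, yet changes 1/(6 t^2)
    only by order 1/t^4, which is invisible at the precision required. *)
Lemma R4_S_ge n :
  1 / 6 / (INR (S n) ^ 2 + 1) - 1 / 6 / (INR (S (S n)) ^ 2 + 1) <= R4 (S n).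
Proof.
  revert n. apply le_of_decrements_le.
  - intros n. rewrite R4_step. rewrite !(S_INR (S _)).
    assert (Hn : 1 <= INR (S n)) by (apply (le_INR 1); lia). revert Hn.
    generalize (INR (S n)); intros t Ht.
    apply Rminus_le.
    replace (1 / 6 / (t ^ 2 + 1) - 1 / 6 / ((t + 1) ^ 2 + 1) -
       (1 / 6 / ((t + 1) ^ 2 + 1) - 1 / 6 / ((t + 1 + 1) ^ 2 + 1)) - / (t + 1) ^ 4)
      (* With s = t + 1, (t^2 + 1)((t+2)^2 + 1) = s^4 + 4, and the numerator is -5 s^4 - 12 s^2 -
         12. *)
      with (((3 * (t + 1) ^ 2 - 2) * (t + 1) ^ 4
             - 3 * ((t ^ 2 + 1) * ((t + 1) ^ 2 + 1) * ((t + 1 + 1) ^ 2 + 1)))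
         * / (3 * ((t ^ 2 + 1) * ((t + 1) ^ 2 + 1) * ((t + 1 + 1) ^ 2 + 1) * (t + 1) ^ 4)))
      by (field; repeat split; nra).
    rewrite <- (Rmult_0_l (/ (3 * ((t ^ 2 + 1) * ((t + 1) ^ 2 + 1) * ((t + 1 + 1) ^ 2 + 1) * (t + 1) ^ 4)))).
    apply Rmult_le_compat_r.
    + left. apply Rinv_0_lt_compat.
      repeat apply Rmult_lt_0_compat; try apply pow_lt; nra.
    + nra.
  - apply (is_lim_seq_decrement (fun n => 1 / 6 / (INR (S n) ^ 2 + 1))), is_lim_seq_inv_sq_succ.
  - apply (is_lim_seq_incr_1 R4), R4_lim.
Qed.

Lemma Q4_ge n : 1 / 6 / (INR (S n) ^ 2 + 1) <= Q4 n.
Proof.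
  revert n. apply le_of_decrements_le.
  - intros n. rewrite Q4_step. apply R4_S_ge.
  - apply is_lim_seq_inv_sq_succ.
  - apply Q4_lim.
Qed.

(** Both bounds on [Q4 n] are 1/(6 (n+1)^2) up to order 1/n^4; re-expanding in n instead of n + 1
    produces the term -1/(3 n^3). *)
Lemma Q4_asymp :
  is_lim_seq (fun n => INR n ^ 3 * (Q4 n - 1 / (6 * INR n ^ 2))) (- (1 / 3)).
Proof.
  apply is_lim_seq_squeeze_inv with (C := 1). intros n.
  assert (H1 := Q4_le (S n)). assert (H2 := Q4_ge (S n)).
  rewrite (S_INR (S n)) in H1, H2.
  assert (Hn : 1 <= INR (S n)) by (apply (le_INR 1); lia). revert Hn H1 H2.
  generalize (INR (S n)) (Q4 (S n)); intros t q Ht H1 H2.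
  assert (Ht3 : 0 < t ^ 3) by (apply pow_lt; lra).
  apply (Rmult_le_compat_l (t ^ 3)) in H1; [|lra].
  apply (Rmult_le_compat_l (t ^ 3)) in H2; [|lra].
  replace (t ^ 3 * (q - 1 / (6 * t ^ 2)) - - (1 / 3)) with (t ^ 3 * q - t / 6 + 1 / 3) by (field; lra).
  assert (E1 : t ^ 3 * (1 / 6 / (t + 1) ^ 2) - t / 6 + 1 / 3 = (3 * t + 2) / (6 * (t + 1) ^ 2))
    by (field; lra).
  assert (E2 : t ^ 3 * (1 / 6 / ((t + 1) ^ 2 + 1)) - t / 6 + 1 / 3
             = (t + 2) / (3 * ((t + 1) ^ 2 + 1))) by (field; nra).
  assert (E3 : 0 <= (t + 2) / (3 * ((t + 1) ^ 2 + 1))) by (apply Rdiv_le_0_compat; nra).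
  assert (E4 : (3 * t + 2) / (6 * (t + 1) ^ 2) <= 1 * / t).
  { apply Rminus_le.
    replace ((3 * t + 2) / (6 * (t + 1) ^ 2) - 1 * / t)
      with (((3 * t + 2) * t - 6 * (t + 1) ^ 2) * / (6 * (t + 1) ^ 2 * t)) by (field; lra).
    rewrite <- (Rmult_0_l (/ (6 * (t + 1) ^ 2 * t))). apply Rmult_le_compat_r; [|nra].
    left. apply Rinv_0_lt_compat. repeat apply Rmult_lt_0_compat; try apply pow_lt; lra. }
  rewrite Rabs_pos_eq; lra.
Qed.

Lemma R4_asymp : is_lim_seq (fun n => INR n ^ 3 * R4 n) (1 / 3).
Proof.
  apply is_lim_seq_squeeze_inv with (C := 1). intros n.
  assert (H1 := R4_S_le n). assert (H2 := R4_S_ge n).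
  rewrite (S_INR (S n)) in H1, H2.
  assert (Hn : 1 <= INR (S n)) by (apply (le_INR 1); lia). revert Hn H1 H2.
  generalize (INR (S n)) (R4 (S n)); intros t r Ht H1 H2.
  assert (Ht3 : 0 < t ^ 3) by (apply pow_lt; lra).
  apply (Rmult_le_compat_l (t ^ 3)) in H1; [|lra].
  apply (Rmult_le_compat_l (t ^ 3)) in H2; [|lra].
  assert (E1 : t ^ 3 * (1 / 6 / t ^ 2 - 1 / 6 / (t + 1) ^ 2) - 1 / 3
      = - ((3 * t + 2) / (6 * (t + 1) ^ 2))) by (field; lra).
  assert (E3 : 0 <= (3 * t + 2) / (6 * (t + 1) ^ 2)) by (apply Rdiv_le_0_compat; nra).
  assert (E2 : - (1 * / t) <=
     t ^ 3 * (1 / 6 / (t ^ 2 + 1) - 1 / 6 / ((t + 1) ^ 2 + 1)) - 1 / 3).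
  { apply Rminus_le.
    replace (- (1 * / t) - (t ^ 3 * (1 / 6 / (t ^ 2 + 1) - 1 / 6 / ((t + 1) ^ 2 + 1)) - 1 / 3))
     with ((t * (3 * t ^ 3 + 6 * t ^ 2 + 4 * t + 4) - 6 * ((t ^ 2 + 1) * ((t + 1) ^ 2 + 1)))
        * / (6 * (t * (t ^ 2 + 1) * ((t + 1) ^ 2 + 1)))) by (field; repeat split; nra).
    rewrite <- (Rmult_0_l (/ (6 * (t * (t ^ 2 + 1) * ((t + 1) ^ 2 + 1))))).
    apply Rmult_le_compat_r; [|nra].
    left. apply Rinv_0_lt_compat. repeat apply Rmult_lt_0_compat; nra. }
  apply Rabs_le_between. split; [|assert (0 < / t) by (apply Rinv_0_lt_compat; lra)]; lra.
Qed.

Lemma is_lim_seq_lower_pow (p : nat) (a : nat -> R) (l : R) :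
  is_lim_seq (fun n => INR n ^ S p * a n) l -> is_lim_seq (fun n => INR n ^ p * a n) 0.
Proof.
  intros H.
  apply (is_lim_seq_ext_loc (fun n => INR n ^ S p * a n * / INR n)).
  - exists 1%nat. intros n Hn. simpl. field. apply not_0_INR; lia.
  - replace (Finite 0) with (Finite (l * 0)) by (f_equal; ring).
    apply is_lim_seq_mult'; [assumption|apply is_lim_seq_inv_INR].
Qed.

Lemma is_lim_seq_sq_Q4 : is_lim_seq (fun n => INR n ^ 2 * Q4 n) (1 / 6).
Proof.
  apply (is_lim_seq_ext_loc
    (fun n => 1 / 6 + INR n ^ 2 * (Q4 n - 1 / (6 * INR n ^ 2)))).
  - exists 1%nat. intros n Hn. field. apply not_0_INR; lia.
  - replace (Finite (1 / 6)) with (Finite (1 / 6 + 0)) by (f_equal; ring).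
    apply is_lim_seq_plus'; [apply is_lim_seq_const|].
    exact (is_lim_seq_lower_pow 2 _ _ Q4_asymp).
Qed.

(** Each 1/j^4 occurs in exactly j of the tails, so the sum is that of 1/j^3. *)
Lemma is_series_R4 : is_series R4 (Series (inv_pow 3)).
Proof.
  apply (is_series_ext (fun n => 1 * tail (inv_pow 4) n)); [intros n; apply Rmult_1_l|].
  apply sum_mul_tail with (W := fun n => INR (S n)).
  - reflexivity.
  - intros n. now rewrite (S_INR (S n)).
  - apply ex_series_inv_pow; lia.
  - apply (is_lim_seq_incr_1 (fun n => INR n * R4 n)).
    apply (is_lim_seq_ext (fun n => INR n ^ 1 * R4 n)); [intros n; ring|].
    apply is_lim_seq_lower_pow with 0, is_lim_seq_lower_pow with (1 / 3), R4_asymp.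
  - apply (is_series_ext (inv_pow 3)).
    + intros n. change (@eq R (inv_pow 3 n) (INR (S n) * inv_pow 4 n)).
      unfold inv_pow. field. apply not_0_INR; lia.
    + apply Series_correct, ex_series_inv_pow; lia.
Qed.

(** The weights 0, ..., j - 1 add up to j(j-1)/2, and j(j-1)/2 times 1/j^4 is half of 1/j^2 -
    1/j^3. *)
Lemma is_series_theta_R4 :
  is_series (theta R4) ((Series (inv_pow 2) - Series (inv_pow 3)) / 2).
Proof.
  apply sum_mul_tail with (W := fun n => INR n * (INR n + 1) / 2).
  - simpl. field.
  - intros n. rewrite S_INR. field.
  - apply ex_series_inv_pow; lia.
  - apply (is_lim_seq_ext
      (fun n => / 2 * (INR (S n) ^ 2 * R4 (S n)) - / 2 * (INR (S n) ^ 1 * R4 (S n)))).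
    { intros n. unfold R4. rewrite S_INR. field. }
    replace (Finite 0) with (Finite (/ 2 * 0 - / 2 * 0)) by (f_equal; ring).
    assert (H2 := is_lim_seq_lower_pow 2 _ _ R4_asymp).
    assert (H1 := is_lim_seq_lower_pow 1 _ _ H2).
    apply is_lim_seq_minus'; (apply is_lim_seq_mult'; [apply is_lim_seq_const|]).
    + now apply (is_lim_seq_incr_1 (fun n => INR n ^ 2 * R4 n)).
    + now apply (is_lim_seq_incr_1 (fun n => INR n ^ 1 * R4 n)).
  - apply (is_series_ext (fun n => (inv_pow 2 n - inv_pow 3 n) * / 2)).
    + intros n.
      change (@eq R ((inv_pow 2 n - inv_pow 3 n) * / 2)
        (INR n * (INR n + 1) / 2 * inv_pow 4 n)).
      unfold inv_pow. rewrite S_INR. assert (H := pos_INR n). field. lra.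
    + apply (is_series_scal_r (/ 2)).
      apply (is_series_minus (K := R_AbsRing) (V := R_NormedModule));
        apply Series_correct, ex_series_inv_pow; lia.
Qed.

(** Summing the tails of [R4] from index 1 on counts [R4 n] exactly n times, so the sum is that of
    [theta R4]. *)
Lemma is_series_Q4 :
  is_series Q4 ((Series (inv_pow 2) - Series (inv_pow 3)) / 2).
Proof.
  apply (is_series_ext (fun n => 1 * tail (fun n => R4 (S n)) n));
    [intros n; apply Rmult_1_l|].
  apply sum_mul_tail with (W := fun n => INR (S n)).
  - reflexivity.
  - intros n. now rewrite (S_INR (S n)).
  - apply (ex_series_incr_1 R4), ex_series_R4.
  - apply (is_lim_seq_incr_1 (fun n => INR n * Q4 n)).
    apply (is_lim_seq_ext (fun n => INR n ^ 1 * Q4 n)); [intros n; ring|].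
    apply is_lim_seq_lower_pow with (1 / 6), is_lim_seq_sq_Q4.
  - apply (is_series_incr_1 (theta R4)).
    replace (theta R4 0%nat) with (@zero R_AbelianGroup)
      by (unfold theta, zero; simpl; ring).
    rewrite plus_zero_r. apply is_series_theta_R4.
Qed.

Lemma sq_asymp_Q4 :
  sq_asymp Q4 (1 / 6) ((Series (inv_pow 2) - Series (inv_pow 3)) / 2).
Proof. split; [apply is_lim_seq_sq_Q4|apply is_series_Q4]. Qed.

Lemma sq_asymp_theta_R4 :
  sq_asymp (theta R4) (1 / 3) ((Series (inv_pow 2) - Series (inv_pow 3)) / 2).
Proof.
  split; [|apply is_series_theta_R4].
  apply (is_lim_seq_ext (fun n => INR n ^ 3 * R4 n)); [|apply R4_asymp].
  intros n; unfold theta; ring.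
Qed.

Lemma sq_asymp_R4 : sq_asymp R4 0 (Series (inv_pow 3)).
Proof.
  split; [|apply is_series_R4]. exact (is_lim_seq_lower_pow 2 _ _ R4_asymp).
Qed.

(** * Reciprocals of log-convex sequences *)

(** Each coefficient of the inverse depends on all earlier ones, so the recursion carries the whole
    table, correct up to index [n]. *)
Fixpoint fps_inv_upto (a : fps) (n : nat) : fps :=
  match n with
  | O => fps_const (/ a 0%nat)
  | S n' => fun k =>
      if Nat.eq_dec k (S n')
      then - / a 0%nat * sum_f_R0 (fun i => fps_inv_upto a n' i * a (S n' - i)%nat) n'
      else fps_inv_upto a n' k
  end.

Definition fps_inv (a : fps) : fps := fun n => fps_inv_upto a n n.

Lemma fps_inv_upto_eq (a : fps) n k : (k <= n)%nat -> fps_inv_upto a n k = fps_inv a k.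
Proof.
  induction n as [|n IH]; intros Hk.
  - replace k with 0%nat by lia. reflexivity.
  - destruct (Nat.eq_dec k (S n)) as [->|Hn]; [reflexivity|].
    simpl. destruct (Nat.eq_dec k (S n)); [contradiction|]. apply IH; lia.
Qed.

Lemma fps_inv_S (a : fps) n :
  fps_inv a (S n)
  = - / a 0%nat * sum_f_R0 (fun i => fps_inv a i * a (S n - i)%nat) n.
Proof.
  unfold fps_inv at 1. cbn [fps_inv_upto].
  destruct (Nat.eq_dec (S n) (S n)); [|contradiction].
  f_equal. apply sum_eq. intros i Hi. now rewrite fps_inv_upto_eq.
Qed.

Lemma fps_mul_inv (a : fps) : a 0%nat <> 0 -> (a * fps_inv a)%fps = fps_const 1.
Proof.
  intros Ha. rewrite fps_mulC. apply functional_extensionality; intros [|n].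
  - unfold PS_mult, fps_inv; simpl. now field.
  - unfold PS_mult. rewrite tech5, fps_inv_S, Nat.sub_diag. simpl fps_const. now field.
Qed.

(* Kaluza's theorem. *)
Lemma fps_inv_nonpos (a : fps) :
  (forall n, 0 < a n) ->
  (forall m n, (m <= n)%nat -> a (S m) * a n <= a m * a (S n)) ->
  forall n, fps_inv a (S n) <= 0.
Proof.
  intros Hp Ha n. induction n as [n IH] using lt_wf_ind.
  rewrite fps_inv_S.
  enough (H : 0 <= sum_f_R0 (fun i => fps_inv a i * a (S n - i)%nat) n).
  { assert (H0 : 0 < / a 0%nat) by apply Rinv_0_lt_compat, Hp.
    assert (H' := Rmult_le_pos _ _ (Rlt_le _ _ H0) H). lra. }
  (* After multiplication by [a n], compare termwise with coefficient [n] of [a * fps_inv a] times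
     [a (S n)], which is nonnegative. The terms at [i = 0] agree; for the others the inverse's
     coefficient is nonpositive and reverses the log-convexity inequality. *)
  apply Rmult_le_reg_r with (a n); [apply Hp|]. rewrite Rmult_0_l.
  apply Rle_trans with ((a * fps_inv a)%fps n * a (S n)).
  - rewrite fps_mul_inv by (apply Rgt_not_eq, Hp).
    apply Rmult_le_pos; [destruct n; simpl; lra|left; apply Hp].
  - rewrite fps_mulC. unfold PS_mult.
    rewrite !(Rmult_comm (sum_f_R0 _ _)), !scal_sum.
    apply sum_Rle. intros [|i] Hi.
    + rewrite !Nat.sub_0_r. right; ring.
    + assert (Hv := IH i ltac:(lia)).
      replace (S n - S i)%nat with (S (n - S i)) by lia.
      assert (H := Ha (n - S i)%nat n ltac:(lia)).
      apply (Rmult_le_compat_neg_l (fps_inv a (S i))) in H; [|assumption].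
      lra.
Qed.

(** In the recurrence for the inverse only the term with index 0 is positive; dropping the others
    leaves [a n / a 0 ^ 2]. *)
Lemma fps_inv_abs_le (a : fps) :
  (forall n, 0 < a n) ->
  (forall m n, (m <= n)%nat -> a (S m) * a n <= a m * a (S n)) ->
  forall n, Rabs (fps_inv a n) <= / a 0%nat ^ 2 * a n.
Proof.
  intros Hp Ha [|n].
  - assert (H := Hp 0%nat). unfold fps_inv; simpl.
    rewrite Rabs_pos_eq by (left; now apply Rinv_0_lt_compat). right. field. lra.
  - assert (H0 := Hp 0%nat). assert (Hn := fps_inv_nonpos a Hp Ha).
    rewrite Rabs_left1 by apply Hn.
    rewrite fps_inv_S.
    enough (H : sum_f_R0 (fun i => fps_inv a i * a (S n - i)%nat) n
                 <= / a 0%nat * a (S n)).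
    { apply (Rmult_le_compat_l (/ a 0%nat)) in H; [|left; now apply Rinv_0_lt_compat].
      replace (/ a 0%nat ^ 2) with (/ a 0%nat * / a 0%nat) by (field; lra). lra. }
    destruct n as [|n]; [right; unfold fps_inv; simpl; ring|].
    rewrite decomp_sum by lia. rewrite Nat.sub_0_r.
    replace (fps_inv a 0%nat) with (/ a 0%nat) by reflexivity.
    enough (H : sum_f_R0 (fun i => fps_inv a (S i) * a (S (S n) - S i)%nat) (pred (S n)) <= 0) by lra.
    rewrite <- (Rmult_0_l (INR (S (pred (S n))))), <- sum_cte.
    apply sum_Rle. intros i _. assert (Hi := Hn i). specialize (Hp (S (S n) - S i)%nat). nra.
Qed.

(** After cancelling [R4 m * R4 n], the tails compare term by term, since (m+1)(n+k+1) <=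
    (n+1)(m+k+1) when m <= n. *)
Lemma R4_ratio m n : (m <= n)%nat -> R4 (S m) * R4 n <= R4 m * R4 (S n).
Proof.
  intros Hmn. assert (Hm := R4_step m). assert (Hn := R4_step n).
  enough (H : / INR (S n) ^ 4 * R4 m <= / INR (S m) ^ 4 * R4 n).
  { replace (R4 (S m)) with (R4 m - / INR (S m) ^ 4) by lra.
    replace (R4 (S n)) with (R4 n - / INR (S n) ^ 4) by lra. lra. }
  unfold R4, tail. rewrite <- !Series_scal_l.
  apply Series_le.
  - intros k. unfold inv_pow.
    assert (Hp : forall j, 0 < INR (S j)) by (intros j; apply lt_0_INR; lia).
    split.
    + left. apply Rmult_lt_0_compat; apply Rinv_0_lt_compat, pow_lt, Hp.
    + rewrite <- !Rinv_mult, <- !Rpow_mult_distr.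
      apply Rinv_le_contravar; [apply pow_lt, Rmult_lt_0_compat; apply Hp|].
      apply pow_incr. split; [apply Rmult_le_pos; left; apply Hp|].
      rewrite <- !mult_INR. apply le_INR. nia.
  - apply (ex_series_scal_l (K := R_AbsRing) (V := R_NormedModule)).
    apply (ex_series_incr_n (inv_pow 4) n), ex_series_inv_pow; lia.
Qed.

Definition V4 : fps := fps_inv R4.

Lemma R4_V4 : (R4 * V4)%fps = fps_const 1.
Proof. apply fps_mul_inv, Rgt_not_eq, R4_pos. Qed.

Lemma V4_abs_le n : Rabs (V4 n) <= / R4 0%nat ^ 2 * R4 n.
Proof. apply fps_inv_abs_le; [apply R4_pos|apply R4_ratio]. Qed.

Lemma ex_series_abs_V4 : ex_series (fun n => Rabs (V4 n)).
Proof.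
  apply ex_series_Rabs_le with (1 := V4_abs_le).
  apply (ex_series_scal_l (K := R_AbsRing) (V := R_NormedModule)), ex_series_R4.
Qed.

Lemma zeta3_series_pos : 0 < Series (inv_pow 3).
Proof.
  apply Rlt_le_trans with (sum_f_R0 R4 0); [apply R4_pos|].
  apply sum_incr; [apply is_series_Reals, is_series_R4|].
  intros n; left; apply R4_pos.
Qed.

Lemma sq_asymp_V4 : sq_asymp V4 0 (/ Series (inv_pow 3)).
Proof.
  assert (H2 := is_lim_seq_lower_pow 2 _ _ R4_asymp).
  assert (HV : is_lim_seq (fun n => INR n ^ 2 * V4 n) 0).
  { apply is_lim_seq_abs_0.
    apply is_lim_seq_le_le with (u := fun _ => 0)
      (w := fun n => / R4 0%nat ^ 2 * (INR n ^ 2 * R4 n)).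
    - intros n. split; [apply Rabs_pos|].
      rewrite Rabs_mult, Rabs_pos_eq by apply pow2_ge_0.
      assert (H := V4_abs_le n). assert (H' := pow2_ge_0 (INR n)).
      apply (Rmult_le_compat_l _ _ _ H') in H. lra.
    - apply is_lim_seq_const.
    - replace (Finite 0) with (Finite (/ R4 0%nat ^ 2 * 0)) by (f_equal; ring).
      apply is_lim_seq_mult'; [apply is_lim_seq_const|assumption]. }
  assert (Hs := Series_correct _ (ex_series_Rabs _ ex_series_abs_V4)).
  (* The sum of [V4] is so far only known to exist; since sums multiply, [R4 * V4 = 1] determines
     it. *)
  assert (Hm := sq_asymp_mul _ _ _ _ _ _ sq_asymp_R4 (conj HV Hs)).
  rewrite R4_V4 in Hm.
  assert (E := is_series_unique _ _ (proj2 Hm)).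
  rewrite (is_series_unique _ _ (proj2 (sq_asymp_const 1))) in E.
  assert (HZ := zeta3_series_pos).
  replace (/ Series (inv_pow 3)) with (Series V4); [now split|].
  apply Rmult_eq_reg_l with (Series (inv_pow 3)); [|lra].
  rewrite <- E. field. lra.
Qed.

(** * Expansion of the coefficients of 1 / (zeta 4 - Li 4) *)

Lemma one_sub_X_mul_0 (a : fps) : ((fps_const 1 - fps_X) * a)%fps 0%nat = a 0%nat.
Proof. unfold PS_mult, fps_sub; simpl. ring. Qed.

Lemma one_sub_X_mul_S (a : fps) n :
  ((fps_const 1 - fps_X) * a)%fps (S n) = a (S n) - a n.
Proof.
  replace ((fps_const 1 - fps_X) * a)%fps with (fps_const 1 * a - fps_X * a)%fps by ring.
  unfold fps_sub. rewrite fps_const_mul, fps_X_mul. ring.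
Qed.

Lemma one_sub_X_mul_Q4 :
  ((fps_const 1 - fps_X) * Q4 = fps_const (Series (inv_pow 3)) - R4)%fps.
Proof.
  apply functional_extensionality; intros [|n]; unfold fps_sub at 2.
  - rewrite one_sub_X_mul_0. simpl fps_const.
    rewrite <- (is_series_unique _ _ is_series_R4), <- (tail_0 R4).
    rewrite <- (tail_step R4 0) by apply ex_series_R4. unfold Q4. ring.
  - rewrite one_sub_X_mul_S. simpl fps_const. rewrite <- Q4_step. ring.
Qed.

Lemma one_sub_X_mul_R4 :
  ((fps_const 1 - fps_X) * R4
   = fps_const (Series (inv_pow 4)) - fps_X * inv_pow 4)%fps.
Proof.
  apply functional_extensionality; intros [|n]; unfold fps_sub at 2.
  - rewrite one_sub_X_mul_0. unfold PS_mult; simpl. unfold R4. rewrite tail_0. ring.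
  - rewrite one_sub_X_mul_S, fps_X_mul. simpl fps_const.
    unfold inv_pow. rewrite <- R4_step. ring.
Qed.

Definition ones : fps := fun _ => 1.

Lemma one_sub_X_mul_ones : ((fps_const 1 - fps_X) * ones)%fps = fps_const 1.
Proof.
  apply functional_extensionality; intros [|n].
  - now rewrite one_sub_X_mul_0.
  - rewrite one_sub_X_mul_S. unfold ones; simpl. ring.
Qed.

Definition U4 : fps := (ones * V4)%fps.

Lemma U4_inverse :
  ((fps_const (Series (inv_pow 4)) - fps_X * inv_pow 4) * U4)%fps = fps_const 1.
Proof.
  rewrite <- one_sub_X_mul_R4. unfold U4.
  transitivity (((fps_const 1 - fps_X) * ones) * (R4 * V4))%fps; [ring|].
  rewrite one_sub_X_mul_ones, R4_V4. ring.
Qed.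

(** This makes the series of [U4] converge absolutely on the open unit disc, as needed to multiply
    it by other series. *)
Lemma U4_bounded n : Rabs (U4 n) <= Series (fun k => Rabs (V4 k)).
Proof.
  eapply Rle_trans; [apply fps_mul_abs_le|].
  eapply Rle_trans; [|apply (sum_Rabs_le_Series V4 n ex_series_abs_V4)].
  rewrite fps_mulC. right. apply sum_eq. intros. unfold ones. rewrite Rabs_R1. ring.
Qed.

Definition P4 : fps := ((fps_const 1 - fps_X) * (Q4 * Q4) * V4)%fps.

Lemma U4_expansion n :
  U4 n = / Series (inv_pow 3) + / Series (inv_pow 3) ^ 2 * (Q4 n + P4 n).
Proof.
  set (mu := Series (inv_pow 3)).
  assert (Hmu : 0 < mu) by apply zeta3_series_pos.
  (* Both [E1] and [E2] split mu as R + (mu - R), use R V = 1, and replace mu - R by (1 - X) Q. *)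
  assert (E1 : (fps_const mu * U4 = ones + Q4 * V4)%fps).
  { unfold U4. transitivity (ones * V4 * (R4 + (fps_const mu - R4)))%fps; [ring|].
    unfold mu; rewrite <- one_sub_X_mul_Q4.
    transitivity (ones * (R4 * V4)
       + ((fps_const 1 - fps_X) * ones) * (Q4 * V4))%fps; [ring|].
    rewrite R4_V4, one_sub_X_mul_ones. ring. }
  assert (E2 : (fps_const mu * (Q4 * V4) = Q4 + P4)%fps).
  { unfold P4.
    transitivity (Q4 + ((fps_const 1 - fps_X) * Q4) * Q4 * V4)%fps; [|ring].
    rewrite one_sub_X_mul_Q4. fold mu.
    transitivity (Q4 + fps_const mu * (Q4 * V4) - (R4 * V4) * Q4)%fps; [|ring].
    rewrite R4_V4. ring. }
  apply (f_equal (fun f => f n)) in E1, E2.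
  rewrite fps_const_mul in E1, E2. unfold fps_add, ones in E1, E2.
  rewrite <- E2. replace (U4 n) with ((1 + (Q4 * V4)%fps n) / mu) by (rewrite <- E1; field; lra).
  field. lra.
Qed.

(** With sigma the common sum of [Q4] and [theta R4], the three terms of [theta_correction] have
    limits sigma/(3 mu), sigma/(2 mu) and sigma/(2 mu), the last two subtracted; the total is -2
    sigma/(3 mu). *)
Lemma P4_asymp :
  is_lim_seq (fun n => INR n ^ 3 * P4 n)
    (- (Series (inv_pow 2) - Series (inv_pow 3)) / (3 * Series (inv_pow 3))).
Proof.
  assert (H := sq_asymp_sub _ _ _ _ _ _
    (sq_asymp_sub _ _ _ _ _ _
      (sq_asymp_mul _ _ _ _ _ _
        (sq_asymp_mul _ _ _ _ _ _ sq_asymp_X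
          (sq_asymp_mul _ _ _ _ _ _ sq_asymp_Q4 sq_asymp_Q4)) sq_asymp_V4)
      (sq_asymp_mul _ _ _ _ _ _
        (sq_asymp_mul _ _ _ _ _ _ sq_asymp_Q4 sq_asymp_V4) sq_asymp_theta_R4))
    (sq_asymp_mul _ _ _ _ _ _ (sq_asymp_const (Series (inv_pow 3)))
      (sq_asymp_mul _ _ _ _ _ _
        (sq_asymp_mul _ _ _ _ _ _ sq_asymp_Q4
          (sq_asymp_mul _ _ _ _ _ _ sq_asymp_V4 sq_asymp_V4)) sq_asymp_theta_R4))).
  rewrite <- (theta_correction _ _ _ _ R4_V4 one_sub_X_mul_Q4) in H.
  destruct H as [H _]. fold P4 in H.
  assert (Hmu := zeta3_series_pos).
  apply (is_lim_seq_ext (fun n => INR n ^ 2 * theta P4 n)).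
  { intros n; unfold theta; ring. }
  match type of H with is_lim_seq _ (Finite ?l) =>
    replace (Finite (- (Series (inv_pow 2) - Series (inv_pow 3)) / (3 * Series (inv_pow 3))))
      with (Finite l); [exact H|f_equal; field; lra] end.
Qed.

Lemma U4_asymp :
  is_lim_seq (fun n => INR n ^ 3 *
     (U4 n - (/ Series (inv_pow 3) + / (6 * Series (inv_pow 3) ^ 2 * INR n ^ 2)
              - Series (inv_pow 2) / (3 * Series (inv_pow 3) ^ 3 * INR n ^ 3)))) 0.
Proof.
  assert (Hmu := zeta3_series_pos).
  assert (HP := P4_asymp). assert (HQ := Q4_asymp).
  set (mu := Series (inv_pow 3)) in *. set (z2 := Series (inv_pow 2)) in *.
  apply (is_lim_seq_ext_loc (fun n => / mu ^ 2 * (INR n ^ 3 * (Q4 n - 1 / (6 * INR n ^ 2))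
      + INR n ^ 3 * P4 n) + z2 / (3 * mu ^ 3))).
  - exists 1%nat. intros n Hn. rewrite U4_expansion. fold mu.
    field. split; [apply not_0_INR; lia|lra].
  (* The -1/3 from [Q4] cancels the +1/3 in the limit for [P4], which leaves only zeta 2 in the
     numerator. *)
  - replace (Finite 0) with (Finite (/ mu ^ 2 * (- (1 / 3) + - (z2 - mu) / (3 * mu)) + z2 / (3 * mu ^ 3)))
      by (f_equal; field; lra).
    apply is_lim_seq_plus'; [|apply is_lim_seq_const].
    apply is_lim_seq_mult'; [apply is_lim_seq_const|].
    now apply is_lim_seq_plus'.
Qed.

(** * Complex power series *)

Lemma is_series_C (x : nat -> C) (l : C) :
  is_series x l <->
  is_series (fun n => Re (x n)) (Re l) /\ is_series (fun n => Im (x n)) (Im l).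
Proof.
  assert (E : forall n, sum_n x n = (sum_n (fun n => Re (x n)) n, sum_n (fun n => Im (x n)) n)).
  { intros n. induction n as [|n IH].
    - rewrite !sum_O. apply surjective_pairing.
    - rewrite !sum_Sn, IH. reflexivity. }
  unfold is_series. split.
  - intros H. split; apply filterlim_locally; intros eps;
      generalize (proj1 (filterlim_locally _ _) H eps); apply filter_imp;
      intros n Hn; rewrite E in Hn; apply Hn.
  - intros [H1 H2]. apply filterlim_locally; intros eps.
    generalize (filter_and _ _ (proj1 (filterlim_locally _ _) H1 eps)
                  (proj1 (filterlim_locally _ _) H2 eps)).
    apply filter_imp. intros n Hn. rewrite E. exact Hn.
Qed.

Lemma pow_n_C (z : C) n : pow_n z n = Cpow z n.
Proof.
  induction n as [|n IH]; [reflexivity|].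
  simpl. rewrite IH. reflexivity.
Qed.

Lemma is_pseries_C (a : fps) (z l : C) :
  is_pseries (fun n => RtoC (a n)) z l <->
  is_series (fun n => a n * Re (z ^ n)%C) (Re l) /\
  is_series (fun n => a n * Im (z ^ n)%C) (Im l).
Proof.
  unfold is_pseries. rewrite is_series_C.
  assert (E : forall n, scal (pow_n z n) (RtoC (a n))
     = (a n * Re (z ^ n)%C, a n * Im (z ^ n)%C)).
  { intros n. rewrite pow_n_C.
    change (Cmult (z ^ n)%C (RtoC (a n)) = (a n * Re (z ^ n)%C, a n * Im (z ^ n)%C)).
    unfold Cmult, RtoC, Re, Im; simpl. f_equal; ring. }
  split; intros [H1 H2]; split;
    [revert H1|revert H2|revert H1|revert H2]; apply is_series_ext; intros n;
    rewrite E; reflexivity.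
Qed.

(** [p] stands for the real or the imaginary parts of the powers of [z]; both are dominated by the
    geometric series. *)
Lemma ex_series_bounded_pow (a : fps) (M : R) (p : nat -> R) (z : C) :
  (forall n, Rabs (a n) <= M) -> Cmod z < 1 -> (forall n, Rabs (p n) <= Cmod (z ^ n)%C) ->
  ex_series (fun n => Rabs (a n * p n)).
Proof.
  intros Ha Hz Hp. apply ex_series_Rabs_le with (b := fun n => M * Cmod z ^ n).
  - intros n. rewrite Rabs_mult, <- Cmod_pow.
    apply Rmult_le_compat; auto using Rabs_pos.
  - apply (ex_series_scal_l (K := R_AbsRing) (V := R_NormedModule)), ex_series_geom.
    rewrite Rabs_pos_eq; [assumption|apply Cmod_ge_0].
Qed.

Lemma Re_abs_le (z : C) : Rabs (Re z) <= Cmod z.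
Proof. eapply Rle_trans; [apply Rmax_l|apply Rmax_Cmod]. Qed.

Lemma Im_abs_le (z : C) : Rabs (Im z) <= Cmod z.
Proof. eapply Rle_trans; [apply Rmax_r|apply Rmax_Cmod]. Qed.

(** Since z^n = z^k z^(n-k), the complex Cauchy product splits into four real ones, each absolutely
    convergent. *)
Lemma is_pseries_C_mul (a b : fps) (z l m : C) (M N : R) :
  (forall n, Rabs (a n) <= M) -> (forall n, Rabs (b n) <= N) -> Cmod z < 1 ->
  is_pseries (fun n => RtoC (a n)) z l -> is_pseries (fun n => RtoC (b n)) z m ->
  is_pseries (fun n => RtoC (PS_mult a b n)) z (Cmult l m).
Proof.
  intros Ha Hb Hz Hl Hm.
  apply is_pseries_C in Hl. apply is_pseries_C in Hm. apply is_pseries_C.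
  destruct Hl as [Hl1 Hl2], Hm as [Hm1 Hm2].
  assert (HaR := ex_series_bounded_pow a M _ z Ha Hz (fun n => Re_abs_le (z ^ n)%C)).
  assert (HaI := ex_series_bounded_pow a M _ z Ha Hz (fun n => Im_abs_le (z ^ n)%C)).
  assert (HbR := ex_series_bounded_pow b N _ z Hb Hz (fun n => Re_abs_le (z ^ n)%C)).
  assert (HbI := ex_series_bounded_pow b N _ z Hb Hz (fun n => Im_abs_le (z ^ n)%C)).
  assert (Epow : forall n k, (k <= n)%nat -> (z ^ n)%C = (z ^ k * z ^ (n - k))%C).
  { intros n k Hk. rewrite <- Cpow_add_r. f_equal. lia. }
  split.
  - apply (is_series_ext (fun n =>
      plus (sum_f_R0 (fun k => (a k * Re (z ^ k)%C) * (b (n - k)%nat * Re (z ^ (n - k))%C)) n)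
      (opp (sum_f_R0 (fun k => (a k * Im (z ^ k)%C) * (b (n - k)%nat * Im (z ^ (n - k))%C)) n)))).
    + intros n. unfold PS_mult.
      change (@eq R (sum_f_R0 (fun k => (a k * Re (z ^ k)%C) * (b (n - k)%nat * Re (z ^ (n - k))%C)) n
        - sum_f_R0 (fun k => (a k * Im (z ^ k)%C) * (b (n - k)%nat * Im (z ^ (n - k))%C)) n)
        (sum_f_R0 (fun k => a k * b (n - k)%nat) n * Re (z ^ n)%C)).
      rewrite <- minus_sum, Rmult_comm, scal_sum. apply sum_eq. intros k Hk.
      rewrite (Epow n k Hk). unfold Cmult, Re, Im; simpl. ring.
    + exact (is_series_minus _ _ _ _ (is_series_mult _ _ _ _ Hl1 Hm1 HaR HbR)
               (is_series_mult _ _ _ _ Hl2 Hm2 HaI HbI)).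
  - apply (is_series_ext (fun n =>
      plus (sum_f_R0 (fun k => (a k * Re (z ^ k)%C) * (b (n - k)%nat * Im (z ^ (n - k))%C)) n)
      (sum_f_R0 (fun k => (a k * Im (z ^ k)%C) * (b (n - k)%nat * Re (z ^ (n - k))%C)) n))).
    + intros n. unfold PS_mult.
      change (@eq R (sum_f_R0 (fun k => (a k * Re (z ^ k)%C) * (b (n - k)%nat * Im (z ^ (n - k))%C)) n
        + sum_f_R0 (fun k => (a k * Im (z ^ k)%C) * (b (n - k)%nat * Re (z ^ (n - k))%C)) n)
        (sum_f_R0 (fun k => a k * b (n - k)%nat) n * Im (z ^ n)%C)).
      rewrite <- sum_plus, Rmult_comm, scal_sum. apply sum_eq. intros k Hk.
      rewrite (Epow n k Hk). unfold Cmult, Re, Im; simpl. ring.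
    + exact (is_series_plus _ _ _ _ (is_series_mult _ _ _ _ Hl1 Hm2 HaR HbI)
               (is_series_mult _ _ _ _ Hl2 Hm1 HaI HbR)).
Qed.

Lemma is_pseries_C_const (c : R) (z : C) :
  is_pseries (fun n => RtoC (fps_const c n)) z (RtoC c).
Proof.
  apply is_pseries_C. split.
  - replace (Re (RtoC c)) with (sum_f_R0 (fun n => fps_const c n * Re (z ^ n)%C) 0)
      by (unfold Re, RtoC; simpl; ring).
    apply is_series_finite. intros [|n] Hn; [lia|simpl; ring].
  - replace (Im (RtoC c)) with (sum_f_R0 (fun n => fps_const c n * Im (z ^ n)%C) 0)
      by (unfold Im, RtoC; simpl; ring).
    apply is_series_finite. intros [|n] Hn; [lia|simpl; ring].
Qed.

(** On real arguments the real and imaginary parts of the coefficients are those of real power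
    series, to which real uniqueness applies. *)
Lemma power_series_at_0_unique (f : C -> C) (a b : nat -> C) :
  power_series_at_0 f a -> power_series_at_0 f b -> forall n, a n = b n.
Proof.
  intros [r Hr] [s Hs].
  assert (Hpos : 0 < Rmin r s) by (apply Rmin_pos; apply cond_pos).
  assert (Hre : forall (a : nat -> C) (x : R), is_pseries a (RtoC x) (f (RtoC x)) ->
     is_series (fun n => Re (a n) * x ^ n) (Re (f (RtoC x))) /\
     is_series (fun n => Im (a n) * x ^ n) (Im (f (RtoC x)))).
  { intros c x H. apply is_series_C in H. destruct H as [H1 H2]. split.
    - revert H1. apply is_series_ext. intros n. rewrite pow_n_C, <- RtoC_pow.
      change (@eq R (Re (RtoC (x ^ n) * c n)%C) (Re (c n) * x ^ n)).
      unfold Re, RtoC, Cmult; simpl. ring.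
    - revert H2. apply is_series_ext. intros n. rewrite pow_n_C, <- RtoC_pow.
      change (@eq R (Im (RtoC (x ^ n) * c n)%C) (Im (c n) * x ^ n)).
      unfold Im, RtoC, Cmult; simpl. ring. }
  assert (Hrad : forall (c : nat -> R) (g : R -> R),
     (forall x, Rabs x < Rmin r s -> is_series (fun n => c n * x ^ n) (g x)) ->
     Rbar_lt 0 (CV_radius c)).
  (* With a radius below half of [Rmin r s], the terms at that half would not tend to 0, although
     the series converges there. *)
  { intros c g H. apply Rbar_lt_le_trans with (Finite (Rmin r s / 2)); [simpl; lra|].
    apply Rbar_not_lt_le. intros Hlt.
    assert (Hab : Rabs (Rmin r s / 2) = Rmin r s / 2) by (apply Rabs_pos_eq; lra).
    rewrite <- Hab in Hlt. apply (CV_disk_outside _ _ Hlt).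
    apply ex_series_lim_0. eexists. apply H. rewrite Hab. lra. }
  assert (Huniq : forall (c d : nat -> R) (g : R -> R),
     (forall x, Rabs x < Rmin r s -> is_series (fun n => c n * x ^ n) (g x)) ->
     (forall x, Rabs x < Rmin r s -> is_series (fun n => d n * x ^ n) (g x)) ->
     forall n, c n = d n).
  { intros c d g Hc Hd n. apply PSeries_ext_recip; [now apply Hrad with g..|].
    exists (mkposreal _ Hpos). intros x Hx.
    assert (Hx' : Rabs x < Rmin r s).
    { replace x with (x - 0) by ring. exact Hx. }
    unfold PSeries. rewrite (is_series_unique _ _ (Hc x Hx')), (is_series_unique _ _ (Hd x Hx')).
    reflexivity. }
  assert (Ha : forall x, Rabs x < Rmin r s -> is_pseries a (RtoC x) (f (RtoC x))).
  { intros x Hx. apply Hr. rewrite Cmod_R. eapply Rlt_le_trans; [exact Hx|apply Rmin_l]. }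
  assert (Hb : forall x, Rabs x < Rmin r s -> is_pseries b (RtoC x) (f (RtoC x))).
  { intros x Hx. apply Hs. rewrite Cmod_R. eapply Rlt_le_trans; [exact Hx|apply Rmin_r]. }
  intros n. rewrite (surjective_pairing (a n)), (surjective_pairing (b n)). f_equal.
  - apply (Huniq (fun n => Re (a n)) (fun n => Re (b n)) (fun x => Re (f (RtoC x))));
      intros x Hx; now apply Hre; auto.
  - apply (Huniq (fun n => Im (a n)) (fun n => Im (b n)) (fun x => Im (f (RtoC x))));
      intros x Hx; now apply Hre; auto.
Qed.

Lemma inv_pow_bounded p n : Rabs (inv_pow p n) <= 1.
Proof.
  assert (H : 1 <= INR (S n) ^ p) by (apply pow_R1_Rle, (le_INR 1); lia).
  unfold inv_pow. rewrite Rabs_pos_eq by (left; apply Rinv_0_lt_compat; lra).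
  rewrite <- Rinv_1. apply Rinv_le_contravar; lra.
Qed.

Lemma Li_term (p n : nat) (z : C) :
  Cdiv (Cpow z (S n)) (RtoC (INR (S n) ^ p))
  = (inv_pow p n * Re (z ^ S n)%C, inv_pow p n * Im (z ^ S n)%C).
Proof.
  unfold Cdiv. rewrite <- RtoC_inv by (apply pow_nonzero, not_0_INR; lia). unfold Cmult, RtoC, Re, Im, inv_pow; cbn [fst snd].
  f_equal; ring.
Qed.

Lemma is_pseries_Li (p : nat) (z : C) :
  Cmod z < 1 -> is_pseries (fun n => RtoC ((fps_X * inv_pow p)%fps n)) z (Li p z).
Proof.
  intros Hz. apply is_pseries_C.
  assert (Hsum : forall (q : C -> R), (forall z, Rabs (q z) <= Cmod z) ->
     is_series (fun n => (fps_X * inv_pow p)%fps n * q (z ^ n)%C)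
       (Series (fun n => inv_pow p n * q (z ^ S n)%C))).
  { intros q Hq.
    apply (is_series_decr_1 (K := R_AbsRing) (V := R_NormedModule)).
    set (L := Series _).
    (* Dropping the term of index 0 asks for the limit [L] minus that term, which is 0. *)
    refine (eq_ind L (fun l => is_series _ l) _ _ _).
    2:{ change (@eq R L (L + - ((fps_X * inv_pow p)%fps 0%nat * q (z ^ 0)%C))).
        unfold PS_mult; simpl; ring. }
    apply (is_series_ext (fun n => inv_pow p n * q (z ^ S n)%C)).
    { intros n. now rewrite fps_X_mul. }
    apply Series_correct, ex_series_Rabs.
    apply (ex_series_bounded_pow _ 1 _ z (inv_pow_bounded p) Hz).
    intros n. eapply Rle_trans; [apply Hq|]. rewrite Cpow_S, Cmod_mult.
    assert (H := Cmod_ge_0 (z ^ n)%C). nra. }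
  split.
  - replace (Re (Li p z)) with (Series (fun n => inv_pow p n * Re (z ^ S n)%C)).
    + apply Hsum, Re_abs_le.
    + apply Series_ext. intros n. now rewrite Li_term.
  - replace (Im (Li p z)) with (Series (fun n => inv_pow p n * Im (z ^ S n)%C)).
    + apply Hsum, Im_abs_le.
    + apply Series_ext. intros n. now rewrite Li_term.
Qed.

Lemma Li_at_1 (p : nat) : Li p (RtoC 1) = RtoC (Series (inv_pow p)).
Proof.
  change (Li p (RtoC 1) = (Series (inv_pow p), 0)). unfold Li, CSeries. f_equal.
  - apply Series_ext. intros n. rewrite Li_term, Cpow_1_l. unfold Re, RtoC; simpl. ring.
  - rewrite (Series_ext _ (fun n => 0 * 0)).
    + rewrite Series_scal_l. ring.
    + intros n. rewrite Li_term, Cpow_1_l. unfold Im, RtoC; simpl. ring.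
Qed.

Lemma zeta_nat (p : nat) : zeta (INR p) = Series (inv_pow p).
Proof.
  apply Series_ext. intros n. unfold inv_pow.
  rewrite Rpower_pow; [reflexivity|apply lt_0_INR; lia].
Qed.

Lemma is_pseries_C_sub (a b : fps) (z l m : C) :
  is_pseries (fun n => RtoC (a n)) z l -> is_pseries (fun n => RtoC (b n)) z m ->
  is_pseries (fun n => RtoC ((a - b)%fps n)) z (Cminus l m).
Proof.
  intros Hl Hm.
  apply is_pseries_C in Hl. apply is_pseries_C in Hm. apply is_pseries_C.
  destruct Hl as [Hl1 Hl2], Hm as [Hm1 Hm2]. split.
  - assert (H := is_series_minus _ _ _ _ Hl1 Hm1). revert H.
    apply is_series_ext. intros n. unfold fps_sub.
    change (@eq R (a n * Re (z ^ n)%C + - (b n * Re (z ^ n)%C)) ((a n - b n) * Re (z ^ n)%C)).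
    ring.
  - assert (H := is_series_minus _ _ _ _ Hl2 Hm2). revert H.
    apply is_series_ext. intros n. unfold fps_sub.
    change (@eq R (a n * Im (z ^ n)%C + - (b n * Im (z ^ n)%C)) ((a n - b n) * Im (z ^ n)%C)).
    ring.
Qed.

Lemma is_pseries_C_unique (a : nat -> C) (z l m : C) :
  is_pseries a z l -> is_pseries a z m -> l = m.
Proof.
  intros Hl Hm. exact (filterlim_locally_unique _ _ _ Hl Hm).
Qed.

Lemma S0_power_series :
  power_series_at_0 S0 (fun n => RtoC ((fps_const (Series (inv_pow 4)) * U4)%fps n)).
Proof.
  exists (mkposreal 1 Rlt_0_1). simpl pos. intros z Hz.
  set (Z4 := Series (inv_pow 4)).
  set (M := Series (fun k => Rabs (V4 k))).
  assert (HU : exists u, is_pseries (fun n => RtoC (U4 n)) z u).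
  { exists (Series (fun n => U4 n * Re (z ^ n)%C), Series (fun n => U4 n * Im (z ^ n)%C)).
    apply is_pseries_C. split; apply Series_correct, ex_series_Rabs.
    - apply (ex_series_bounded_pow U4 M _ z U4_bounded Hz (fun n => Re_abs_le (z ^ n)%C)).
    - apply (ex_series_bounded_pow U4 M _ z U4_bounded Hz (fun n => Im_abs_le (z ^ n)%C)). }
  destruct HU as [u Hu].
  assert (HC : forall c n, Rabs (fps_const c n) <= Rabs c).
  { intros c [|n]; simpl; [lra|]. rewrite Rabs_R0. apply Rabs_pos. }
  assert (HD := is_pseries_C_sub _ _ _ _ _ (is_pseries_C_const Z4 z) (is_pseries_Li 4 z Hz)).
  assert (HX : forall n, Rabs ((fps_X * inv_pow 4)%fps n) <= 1).
  { intros [|n]; [unfold PS_mult; simpl; rewrite Rmult_0_l, Rabs_R0; lra|].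
    rewrite fps_X_mul. apply inv_pow_bounded. }
  assert (HDb : forall n, Rabs ((fps_const Z4 - fps_X * inv_pow 4)%fps n) <= Rabs Z4 + 1).
  { intros n. unfold fps_sub. eapply Rle_trans; [apply Rabs_triang|].
    rewrite Rabs_Ropp. apply Rplus_le_compat; auto. }
  assert (H1 := is_pseries_C_mul _ _ _ _ _ _ _ HDb U4_bounded Hz HD Hu).
  unfold Z4 in H1. rewrite U4_inverse in H1. fold Z4 in H1.
  assert (E := is_pseries_C_unique _ _ _ _ H1 (is_pseries_C_const 1 z)).
  assert (HS : S0 z = Cmult (RtoC Z4) u).
  { unfold S0. rewrite Li_at_1. fold Z4.
    (* By [E] the denominator times [u] is 1, so it cannot vanish anywhere in the open unit disc. *)
    assert (Hne : Cminus (RtoC Z4) (Li 4 z) <> RtoC 0).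
    { intros H0. rewrite H0, Cmult_0_l in E. apply RtoC_inj in E. lra. }
    set (D := Cminus (RtoC Z4) (Li 4 z)) in *.
    transitivity (Cdiv (Cmult (RtoC Z4) (Cmult D u)) D).
    - rewrite E. now rewrite Cmult_1_r.
    - field. exact Hne. }
  rewrite HS. exact (is_pseries_C_mul _ _ _ _ _ _ _ (HC Z4) U4_bounded Hz (is_pseries_C_const Z4 z) Hu).
Qed.

Theorem mainTheorem4 :
  (exists s : nat -> C, power_series_at_0 S0 s) /\
  (forall s : nat -> C, power_series_at_0 S0 s ->
     is_domin eventually
       (fun n : nat => (/ INR n ^ 3)%R)
       (fun n : nat =>
          Cminus (s n)
            (RtoC (PI ^ 4 / (90 * zeta 3)
                   + PI ^ 4 / (540 * zeta 3 ^ 2 * INR n ^ 2)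
                   - PI ^ 6 / (1620 * zeta 3 ^ 3 * INR n ^ 3))%R))).
Proof.
  split; [eexists; apply S0_power_series|].
  intros s Hs eps.
  assert (E3 : zeta 3 = Series (inv_pow 3)).
  { rewrite <- zeta_nat. f_equal. simpl. ring. }
  assert (E2 : Series (inv_pow 2) = PI ^ 2 / 6) by apply is_series_unique, is_series_inv_sq.
  assert (E4 : Series (inv_pow 4) = PI ^ 4 / 90) by apply is_series_unique, is_series_inv_pow4.
  assert (Hmu := zeta3_series_pos). assert (HPI := PI_RGT_0).
  assert (HL := U4_asymp). apply is_lim_seq_spec in HL.
  assert (H4 : 0 < Series (inv_pow 4)) by (rewrite E4; apply Rdiv_lt_0_compat; [apply pow_lt|]; lra).
  (* The coefficients of [S0] are zeta 4 times [U4], hence the division of [eps] by zeta 4. *)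
  destruct (HL (mkposreal _ (Rdiv_lt_0_compat _ _ (cond_pos eps) H4))) as [N HN].
  (* [S N] rather than [N] keeps [n] positive, so that powers of n are invertible. *)
  exists (S N). intros n Hn. simpl pos in HN. specialize (HN n ltac:(lia)).
  rewrite (power_series_at_0_unique _ _ _ Hs S0_power_series n), fps_const_mul.
  rewrite <- RtoC_minus.
  match goal with |- context [RtoC ?d] => change (Cmod (RtoC d) <= eps * Rabs (/ INR n ^ 3)) end.
  rewrite Cmod_R, E3.
  assert (Hn0 : 0 < INR n) by (apply lt_0_INR; lia).
  assert (Hn3 : 0 < INR n ^ 3) by now apply pow_lt.
  rewrite (Rabs_pos_eq (/ _)) by (left; now apply Rinv_0_lt_compat).
  rewrite Rminus_0_r, Rabs_mult, (Rabs_pos_eq (INR n ^ 3)) in HN by lra.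
  set (mu := Series (inv_pow 3)) in *.
  set (d := U4 n - _) in HN.
  replace (Series (inv_pow 4) * U4 n - _) with (Series (inv_pow 4) * d).
  2:{ unfold d. rewrite E4, E2. field. lra. }
  rewrite Rabs_mult, (Rabs_pos_eq (Series (inv_pow 4))) by lra.
  apply Rmult_le_reg_l with (INR n ^ 3 / Series (inv_pow 4)); [now apply Rdiv_lt_0_compat|].
  replace (INR n ^ 3 / Series (inv_pow 4) * (Series (inv_pow 4) * Rabs d))
    with (INR n ^ 3 * Rabs d) by (field; lra).
  replace (INR n ^ 3 / Series (inv_pow 4) * (eps * / INR n ^ 3))
    with (eps / Series (inv_pow 4)) by (field; lra).
  lra.
Qed.
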